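(* Let $b_+,b_->0$, $\delta_\pm\in\mathbb R$ with $b_\pm+\delta_\pm>0$, and $c>0$, and let $\hat H_{\mathrm{II}}(k)$ be the type-II interface Hamiltonian defined in the context. (i) If $\delta_+\delta_-<0$, then $0$ is a two-fold eigenvalue of $\hat H_{\mathrm{II}}(0)$ (its eigenspace in $\ell^2(\mathbb Z;\mathbb C^6)$ is two-dimensional). (ii) If $\delta_+\delta_->0$, then $\hat H_{\mathrm{II}}(0)$ is invertible; consequently $0$ is not an eigenvalue of $\hat H_{\mathrm{II}}(0)$.
   Context: Coefficients: for $n\in\mathbb Z$ let $b_n=b_+$ for $n\ge0$ and $b_n=b_-$ for $n\le-1$; $c_n=b_++\delta_+$ for $n\ge0$, $c_{-1}=c$, $c_n=b_-+\delta_-$ for $n\le-2$; $d_n=b_++\delta_+$ for $n\ge0$, $d_{-1}=d_{-2}=c$, $d_n=b_-+\delta_-$ for $n\le-3$. For $k\in[-\pi,\pi)$, $\hat H_{\mathrm{II}}(k)$ is the bounded self-adjoint operator on $\ell^2(\mathbb Z;\mathbb C^6)$ acting on $w=\{(w_{j,n})_{j=1}^6\}_{n\in\mathbb Z}$ by $(\hat H_{\mathrm{II}}(k)w)_{1,n}=-b_nw_{4,n}-b_nw_{5,n}-c_ne^{-ik}w_{6,n+1}$, $(\hat H_{\mathrm{II}}(k)w)_{2,n}=-b_nw_{4,n}-d_{n-2}e^{ik}w_{5,n-2}-b_nw_{6,n}$, $(\hat H_{\mathrm{II}}(k)w)_{3,n}=-c_nw_{4,n+1}-b_nw_{5,n}-b_nw_{6,n}$,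 $(\hat H_{\mathrm{II}}(k)w)_{4,n}=-b_nw_{1,n}-b_nw_{2,n}-c_{n-1}w_{3,n-1}$, $(\hat H_{\mathrm{II}}(k)w)_{5,n}=-b_nw_{1,n}-d_ne^{-ik}w_{2,n+2}-b_nw_{3,n}$, $(\hat H_{\mathrm{II}}(k)w)_{6,n}=-c_{n-1}e^{ik}w_{1,n-1}-b_nw_{2,n}-b_nw_{3,n}$. *)

(* Defs.v *)
From HB Require Import structures.
From mathcomp Require Import all_boot all_order all_algebra.
From mathcomp Require Import all_classical all_reals all_analysis.
From mathcomp Require Import complex.
Set Implicit Arguments. Unset Strict Implicit. Unset Printing Implicit Defensive.
Import Order.TTheory GRing.Theory Num.Theory.
Local Open Scope ring_scope.

Section TypeII.
Variable R : realType.
Local Notation C := R[i].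

Definition rC (x : R) : C := Complex x 0.
Definition expi (k : R) : C := Complex (cos k) (sin k).

Definition bcoef (bp bm : R) (n : int) : R := if (0 <= n)%R then bp else bm.
Definition ccoef (bp bm dp dm c : R) (n : int) : R :=
  if (0 <= n)%R then bp + dp else if n == (-1)%R then c else bm + dm.
Definition dcoef (bp bm dp dm c : R) (n : int) : R :=
  if (0 <= n)%R then bp + dp
  else if (n == (-1)%R) || (n == (-2)%R) then c else bm + dm.

(* sequences in C^6 indexed by Z: w n j is w_{j+1,n} (components 0..5) *)
Definition seq6 := int -> 'I_6 -> C.

Definition comp (w : seq6) (j : nat) (n : int) : C := w n (inord j).

Definition H_II (bp bm dp dm c k : R) (w : seq6) : seq6 :=
  fun n j =>
  let b := fun m => rC (bcoef bp bm m) in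
  let cn := fun m => rC (ccoef bp bm dp dm c m) in
  let dn := fun m => rC (dcoef bp bm dp dm c m) in
  let w1 := comp w 0 in let w2 := comp w 1 in let w3 := comp w 2 in
  let w4 := comp w 3 in let w5 := comp w 4 in let w6 := comp w 5 in
  match val j with
  | 0 => - b n * w4 n - b n * w5 n - cn n * (expi k)^-1 * w6 (n + 1)
  | 1 => - b n * w4 n - dn (n - 2) * expi k * w5 (n - 2) - b n * w6 n
  | 2 => - cn n * w4 (n + 1) - b n * w5 n - b n * w6 n
  | 3 => - b n * w1 n - b n * w2 n - cn (n - 1) * w3 (n - 1)
  | 4 => - b n * w1 n - dn n * (expi k)^-1 * w2 (n + 2) - b n * w3 n
  | _ => - cn (n - 1) * expi k * w1 (n - 1) - b n * w2 n - b n * w3 n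
  end.

Definition sqmod (z : C) : R := (complex.Re z) ^+ 2 + (complex.Im z) ^+ 2.
Definition ptnorm2 (v : 'I_6 -> C) : R := \sum_(j < 6) sqmod (v j).

Definition l2norm2 (w : seq6) : \bar R :=
  (\sum_(0 <= n <oo) (ptnorm2 (w (Posz n)) + ptnorm2 (w (Negz n)))%:E)%E.

Definition in_l2 (w : seq6) : Prop := (l2norm2 w < +oo)%E.

Definition zero6 : seq6 := fun _ _ => 0.
Definition add6 (u v : seq6) : seq6 := fun n j => u n j + v n j.
Definition scale6 (a : C) (u : seq6) : seq6 := fun n j => a * u n j.

Definition in_kernel (bp bm dp dm c k : R) (w : seq6) : Prop :=
  in_l2 w /\ H_II bp bm dp dm c k w = zero6.

Definition kernel_dim2 (bp bm dp dm c k : R) : Prop :=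
  exists u v : seq6,
    [/\ in_kernel bp bm dp dm c k u, in_kernel bp bm dp dm c k v,
        (forall a b : C, add6 (scale6 a u) (scale6 b v) = zero6 -> a = 0 /\ b = 0)
      & forall w, in_kernel bp bm dp dm c k w ->
          exists a b : C, w = add6 (scale6 a u) (scale6 b v)].

Definition invertible_on_l2 (bp bm dp dm c k : R) : Prop :=
  exists G : seq6 -> seq6,
    [/\ (forall w, in_l2 w -> in_l2 (G w)),
        (forall a b u v, in_l2 u -> in_l2 v ->
           G (add6 (scale6 a u) (scale6 b v)) = add6 (scale6 a (G u)) (scale6 b (G v))),
        (exists K : R, forall w, in_l2 w -> (l2norm2 (G w) <= K%:E * l2norm2 w)%E),
        (forall w, in_l2 w -> G (H_II bp bm dp dm c k w) = w)
      & (forall w, in_l2 w -> H_II bp bm dp dm c k (G w) = w)].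

Definition zero_eigenvalue (bp bm dp dm c k : R) : Prop :=
  exists w, in_kernel bp bm dp dm c k w /\ w <> zero6.

End TypeII.

(* Main.v *)
(** At k = 0 the Hamiltonian is real and off-diagonal, and its two off-diagonal
    blocks have the same form up to the reflection n -> -n. In such a block the
    difference s = w4 - w6 obeys a first order recursion with asymptotic ratio
    b/(b + delta), and after elimination of w4 + w6 the component q = w5 obeys a
    second order one, 2 q_n = rho^2 q_(n-1) + rho q_(n-2) with
    rho = (b + delta)/b at both ends. All coefficients being positive, a
    Riccati recursion factors the second order operator into two first order
    ones: one is always contracting, the other has asymptotic ratio the positive
    characteristic root, which is > 1 exactly when rho > 1. A first order
    operator f_n - a_n f_(n-1) is invertible on l^2(Z) if |a| is < 1 at both
    ends or > 1 at both ends, has a one-dimensional kernel if |a| > 1 on the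
    left and < 1 on the right, and is injective if |a| < 1 on the left and > 1
    on the right. If delta_+ delta_- < 0, each block thus has exactly one zero
    mode; otherwise both blocks are invertible. *)

Require Import Defs.
From HB Require Import structures.
From mathcomp Require Import all_boot all_order all_algebra.
From mathcomp Require Import all_classical all_reals all_analysis.
From mathcomp Require Import complex.
From mathcomp Require Import zify ring lra.
Import Order.TTheory GRing.Theory Num.Theory.
Import numFieldNormedType.Exports.
Set Implicit Arguments. Unset Strict Implicit. Unset Printing Implicit Defensive.
Local Open Scope ring_scope.

(** * Square-summable real sequences on the integers, with explicit bounds *)

Section SquareSummable.
Variable R : realType.
Implicit Types (f g h a : int -> R) (M K : R).

(** [M] bounds the squared norm. Testing on finite duplicate-free lists makes invariance under
    injective reindexing immediate and avoids fixing an enumeration of the integers. *)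
Definition l2le f M : Prop :=
  forall s : seq int, uniq s -> \sum_(n <- s) f n ^+ 2 <= M.

Definition l2 f : Prop := exists M, l2le f M.

Lemma l2le_ge0 f M : l2le f M -> 0 <= M.
Proof. by move=> /(_ [::] isT); rewrite big_nil. Qed.

Lemma l2le_point f M n : l2le f M -> f n ^+ 2 <= M.
Proof. by move=> /(_ [:: n] isT); rewrite big_seq1. Qed.

Lemma l2le_abs f M n : l2le f M -> `|f n| <= M + 1.
Proof.
move=> fM; have := l2le_point n fM; have := l2le_ge0 fM.
rewrite -(real_normK (num_real (f n))) => M0 nM.
have := normr_ge0 (f n); nra.
Qed.

Lemma l2le_lin2 f g h M M' (A B : R) : 0 <= A -> 0 <= B ->
  (forall n, h n ^+ 2 <= A * f n ^+ 2 + B * g n ^+ 2) ->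
  l2le f M -> l2le g M' -> l2le h (A * M + B * M').
Proof.
move=> A0 B0 hfg fM gM s us.
apply: (@le_trans _ _ (\sum_(n <- s) (A * f n ^+ 2 + B * g n ^+ 2))).
  by apply: ler_sum => n _; exact: hfg.
rewrite big_split /= -!mulr_sumr.
by apply: lerD; apply: ler_wpM2l => //; [exact: fM|exact: gM].
Qed.

Lemma l2le_mono f M M' : M <= M' -> l2le f M -> l2le f M'.
Proof. by move=> MM fM s us; apply: le_trans MM; exact: fM. Qed.

Lemma l2le0 M : 0 <= M -> l2le (fun=> 0) M.
Proof.
by move=> M0 s _; rewrite big1 // => i _; rewrite expr0n.
Qed.

Lemma l2leD f g M M' : l2le f M -> l2le g M' ->
  l2le (fun n => f n + g n) (2 * M + 2 * M').
Proof. by apply: l2le_lin2 => // n; have := sqr_ge0 (f n - g n); nra. Qed.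

Lemma l2leM a f (B : R) M : (forall n, `|a n| <= B) -> l2le f M ->
  l2le (fun n => a n * f n) (B ^+ 2 * M).
Proof.
move=> aB fM.
have -> : B ^+ 2 * M = B ^+ 2 * M + 0 * M by rewrite mul0r addr0.
apply: l2le_lin2 (fM) (fM); rewrite ?sqr_ge0 // => n.
rewrite mul0r addr0 exprMn ler_wpM2r ?sqr_ge0 //.
rewrite -(real_normK (num_real (a n))) lerXn2r ?nnegrE //.
exact: le_trans (aB n).
Qed.

Lemma l2leZ f M (B : R) : l2le f M -> l2le (fun n => B * f n) (B ^+ 2 * M).
Proof.
by move=> fM; rewrite -(real_normK (num_real B)); exact: l2leM.
Qed.

Lemma l2le_reindex f M (t : int -> int) : injective t ->
  l2le f M -> l2le (fun n => f (t n)) M.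
Proof.
move=> it fM s us; rewrite -(big_map t xpredT (fun n => f n ^+ 2)).
by apply: fM; rewrite map_inj_uniq.
Qed.

Lemma l2le_shift f M (k : int) : l2le f M -> l2le (fun n => f (n + k)) M.
Proof. by apply: l2le_reindex => x y; exact: addIr. Qed.

Lemma l2le_reflect f M (k : int) : l2le f M -> l2le (fun n => f (k - n)) M.
Proof. by apply: l2le_reindex => x y /addrI/oppr_inj. Qed.

Lemma l2D f g : l2 f -> l2 g -> l2 (fun n => f n + g n).
Proof. by move=> [M fM] [M' gM]; eexists; exact: (l2leD fM gM). Qed.

Lemma l2Z f (B : R) : l2 f -> l2 (fun n => B * f n).
Proof. by move=> [M fM]; eexists; exact: l2leZ fM. Qed.

Lemma l2_shift f (k : int) : l2 f -> l2 (fun n => f (n + k)).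
Proof. by move=> [M fM]; exists M; exact: l2le_shift. Qed.

Lemma l2_reflect f (k : int) : l2 f -> l2 (fun n => f (k - n)).
Proof. by move=> [M fM]; exists M; exact: l2le_reflect. Qed.

Lemma l2_0 : l2 (fun=> 0).
Proof. by exists 0; exact: l2le0. Qed.

Lemma eq_l2 f g : (forall n, f n = g n) -> l2 f -> l2 g.
Proof. by move=> /funext ->. Qed.

Definition bdd a : Prop := exists B : R, forall n, `|a n| <= B.

Lemma l2M a f : bdd a -> l2 f -> l2 (fun n => a n * f n).
Proof. by move=> [B aB] [M fM]; eexists; exact: l2leM aB fM. Qed.

End SquareSummable.

(** * First order recursions: the contracting case by Picard iteration *)

Section FirstOrder.
Local Open Scope classical_set_scope.
Variable R : realType.
Implicit Types (f g a : int -> R).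

(** A right inverse of f_n - a_n f_(n-1) with a norm bound: [K] is chosen before [g]. *)
Definition first_order_solvable a : Prop := exists2 K : R, 0 <= K &
  forall M g, l2le g M -> exists2 f, l2le f (K * M) &
    forall n, f n = a n * f (n - 1) + g n.

Definition first_order_injective a : Prop := forall f, l2 f ->
  (forall n, f n = a n * f (n - 1)) -> forall n, f n = 0.

Definition stable_right a : Prop := exists t : R, exists N : nat,
  t < 1 /\ forall n : int, N%:Z <= n -> `|a n| <= t.

Definition stable_left a : Prop := exists t : R, exists N : nat,
  t < 1 /\ forall n : int, n <= - N%:Z -> `|a n| <= t.

Definition unstable_right a : Prop := exists t : R, exists N : nat,
  1 < t /\ forall n : int, N%:Z <= n -> t <= `|a n|.

Definition unstable_left a : Prop := exists t : R, exists N : nat,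
  1 < t /\ forall n : int, n <= - N%:Z -> t <= `|a n|.

Lemma geometric_small (t e : R) : 0 <= t < 1 -> 0 < e ->
  exists N : nat, forall n, (N <= n)%N -> t ^+ n < e.
Proof.
move=> /andP[t0 t1] e0.
have /cvgrPdist_lt /(_ e e0) [N _ NP] : (GRing.exp t : R ^nat) @ \oo --> (0 : R).
  by apply: cvg_expr; rewrite ger0_norm.
exists N => n Nn; have := NP n Nn.
by rewrite /= sub0r normrN ger0_norm ?exprn_ge0.
Qed.

(** Serves as a Fatou-type step: a bound on the finite sums that holds along the iterates passes to
    their pointwise limit. *)
Lemma sum_cvg (s : seq int) (F : nat -> int -> R) f :
  (forall n, (fun k => F k n) @ \oo --> f n) ->
  (fun k => \sum_(n <- s) F k n ^+ 2) @ \oo --> \sum_(n <- s) f n ^+ 2.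
Proof.
move=> Ff; elim: s => [|n s IH].
  rewrite big_nil; under eq_fun do rewrite big_nil; exact: cvg_cst.
rewrite big_cons; under eq_fun do rewrite big_cons.
by apply: cvgD => //; rewrite expr2; under eq_fun do rewrite expr2; exact: cvgM.
Qed.

Fixpoint picard a g (k : nat) : int -> R :=
  if k is k'.+1 then fun n => a n * picard a g k' (n - 1) + g n else fun=> 0.

(* Convexity, (t x + y)^2 <= t x^2 + y^2 / (1 - t), keeps all Picard iterates
   in the ball of squared radius M / (1 - t)^2. *)
Lemma picard_l2le a g (t M : R) k : 0 <= t < 1 -> (forall n, `|a n| <= t) ->
  l2le g M -> l2le (picard a g k) ((1 - t) ^- 2 * M).
Proof.
move=> /andP[t0 t1] at' gM; have M0 := l2le_ge0 gM.
have s0 : 0 < 1 - t by rewrite subr_gt0.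
elim: k => [|k IH] /=.
  by apply: l2le0; rewrite mulr_ge0 // invr_ge0 exprn_ge0 // ltW.
have -> : (1 - t) ^- 2 * M = t * ((1 - t) ^- 2 * M) + (1 - t)^-1 * M.
  by field; rewrite gt_eqF.
apply: l2le_lin2 (l2le_shift (-1) IH) gM => //; first by rewrite invr_ge0 ltW.
move=> n; set x := picard _ _ _ _; set y := g n.
have h : forall z : R, z = (1 - t)^-1 * y -> (a n * x + y) ^+ 2 <= t * x ^+ 2 + z * y.
  move=> z zE; have -> : y = (1 - t) * z by rewrite zE mulrA mulfV ?mul1r // gt_eqF.
  have a2 : a n ^+ 2 <= t ^+ 2.
    by rewrite -(real_normK (num_real (a n))) lerXn2r ?nnegrE.
  have := at' n; rewrite ler_norml => /andP[an1 an2].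
  have h1 : (a n * x + (1 - t) * z) ^+ 2 <= t * x ^+ 2 + (1 - t) * z ^+ 2.
    (* The right side minus the left is the expression in [e1] plus half the one in [e2]. *)
    have e1 : 0 <= (t ^+ 2 - a n ^+ 2) * x ^+ 2 by apply: mulr_ge0; rewrite ?subr_ge0 ?sqr_ge0.
    have e2 : 0 <= (1 - t) * ((t + a n) * (x - z) ^+ 2 + (t - a n) * (x + z) ^+ 2).
      apply: mulr_ge0; first exact: ltW.
      by apply: addr_ge0; apply: mulr_ge0; rewrite ?sqr_ge0 //; lra.
    nra.
  by apply: le_trans h1 _; rewrite le_eqVlt; apply/orP; left; apply/eqP; ring.
by have := h _ erefl; rewrite -mulrA -expr2.
Qed.

Lemma picard_diff a g (t B : R) k n : 0 <= t -> (forall n, `|a n| <= t) ->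
  (forall n, `|g n| <= B) ->
  `|picard a g k.+1 n - picard a g k n| <= B * t ^+ k.
Proof.
move=> t0 at' gB; elim: k n => [|k IH] n /=.
  by rewrite mulr0 add0r subr0 expr0 mulr1.
rewrite opprD addrACA subrr addr0 -mulrBr normrM exprS mulrCA.
by apply: ler_pM => //; exact: IH.
Qed.

(** The Picard iterates converge pointwise, their increments being dominated by a geometric series
    of ratio [t]. The limit inherits the uniform bound and the equation. *)
Lemma contraction_solve a g (t M : R) : 0 <= t < 1 -> (forall n, `|a n| <= t) ->
  l2le g M -> exists2 f, l2le f ((1 - t) ^- 2 * M) &
    forall n, f n = a n * f (n - 1) + g n.
Proof.
move=> t01 at' gM; have /andP[t0 t1] := t01.
have cv n : cvgn (fun k => picard a g k n).
  have -> : (fun k => picard a g k n) = series (telescope (fun k => picard a g k n)).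
    by apply/funext => k; rewrite telescopeK /= subr0.
  apply: normed_cvg; apply: (@series_le_cvg _ _ (geometric (M + 1) t)).
  - by move=> k /=.
  - by move=> k /=; rewrite mulr_ge0 ?exprn_ge0 // addr_ge0 // (l2le_ge0 gM).
  - by move=> k /=; apply: picard_diff => // m; exact: l2le_abs gM.
  - by apply: is_cvg_geometric_series; rewrite ger0_norm.
pose f n : R := limn (fun k => picard a g k n).
have cvf n : (fun k => picard a g k n) @ \oo --> f n by exact: cv.
exists f.
  move=> s us; apply: (cvgr_to_le (sum_cvg (s := s) cvf)).
  by apply: nearW => k; exact: (picard_l2le k t01 at' gM).
move=> n; apply: cvg_lim => //; rewrite -cvg_shiftS /=.
by apply: cvgD; [apply: cvgMl_tmp; exact: cvf | exact: cvg_cst].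
Qed.

End FirstOrder.

(** * Solvability, injectivity and kernel, read off from the coefficient at the two ends *)

Section FirstOrderTheory.
Variable R : realType.
Implicit Types (f g a : int -> R).

Lemma int_ind_up (P : int -> Prop) (m : int) : P m ->
  (forall n, m <= n -> P n -> P (n + 1)) -> forall n, m <= n -> P n.
Proof.
move=> P0 PS n mn; have -> : n = m + `|n - m|%N%:Z by lia.
elim: `|n - m|%N => [|k IH]; first by rewrite addr0.
have -> : m + k.+1%:Z = (m + k%:Z) + 1 by lia.
by apply: PS => //; lia.
Qed.

(* The weight K ^ (clamp n) absorbs the finitely many coefficients that are
   not contracting. *)
Lemma stable_solvable a : bdd a -> stable_left a -> stable_right a ->
  first_order_solvable a.
Proof.
move=> [B aB] [t1 [N1 [t1lt ha1]]] [t2 [N2 [t2lt ha2]]].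
(* The 1/2 keeps [t] positive, so that [K] can be defined by dividing by it. *)
pose t := Num.max (2^-1) (Num.max t1 t2).
have th : 2^-1 <= t by rewrite le_max lexx.
have t01 : 0 <= t < 1.
  rewrite !gt_max t1lt t2lt !andbT; apply/andP; split; lra.
have tp : 0 < t by lra.
pose N := (N1 + N2)%N.
have hN (n : int) : n <= - N%:Z \/ N%:Z <= n -> `|a n| <= t.
  move=> h; rewrite !le_max; case: h => h; apply/orP; right; apply/orP.
    by left; apply: ha1; lia.
  by right; apply: ha2; lia.
pose K := Num.max 1 (B / t).
have K1 : 1 <= K by rewrite le_max lexx.
have KB : B <= t * K.
  by rewrite mulrC -ler_pdivrMr // le_max lexx orbT.
pose e (n : int) : nat := minn (N + N) (if (0 <= n + N%:Z)%R then `|(n + N%:Z)%R|%N else 0%N).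
pose w n := K ^+ e n.
have w1 n : 1 <= w n by rewrite exprn_ege1.
have w0 n : w n != 0 by rewrite gt_eqF // (lt_le_trans ltr01).
have wi n : `|(w n)^-1| <= 1.
  by rewrite ger0_norm ?invr_ge0 ?(le_trans ler01) // invf_le1 // (lt_le_trans ltr01).
have wM n : `|w n| <= K ^+ (N + N).
  by rewrite ger0_norm ?(le_trans ler01) // ler_weXn2l // geq_minl.
pose a' n := a n * w (n - 1) / w n.
have a't n : `|a' n| <= t.
  (* Outside the window -N < n <= N the weight does not change from n - 1 to n, so a' = a. Inside,
     the exponent grows by one and a' = a / K, of modulus at most [t] because [B <= t * K]. *)
  have [nN|nN] : (n <= - N%:Z \/ N%:Z < n) \/ (- N%:Z < n /\ n <= N%:Z) by lia.
    have ee : e (n - 1) = e n.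
      rewrite /e; case: ifP; case: ifP; lia.
    have -> : a' n = a n by rewrite /a' /w ee mulfK // w0.
    by apply: hN; lia.
  have ee : e n = (e (n - 1)).+1.
    rewrite /e; case: ifP; case: ifP; lia.
  have -> : a' n = a n / K.
    rewrite /a' /w ee exprS; field.
    by rewrite -/(w (n - 1)) w0 gt_eqF // (lt_le_trans ltr01).
  have Kp : 0 < K by rewrite (lt_le_trans ltr01).
  rewrite normrM normfV (gtr0_norm Kp) ler_pdivrMr //.
  exact: le_trans KB.
exists ((K ^+ (N + N)) ^+ 2 * (1 - t) ^- 2).
  rewrite mulr_ge0 ?sqr_ge0 // invr_ge0 exprn_ge0 //; lra.
move=> M g gM.
have gM' : l2le (fun n => (w n)^-1 * g n) M.
  by rewrite -[M]mul1r -(expr1n _ 2); exact: l2leM.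
have [f fM fE] := contraction_solve t01 a't gM'.
exists (fun n => w n * f n).
  by rewrite -mulrA; exact: l2leM.
move=> n; rewrite fE /a'; field; exact: w0.
Qed.

(** Iterating the recursion k times to the left bounds f_n by t^k times a constant, since an l^2
    sequence is bounded. Hence f vanishes far to the left, and the recursion carries the zero to the
    right. *)
Lemma stable_left_injective a : stable_left a -> first_order_injective a.
Proof.
move=> [t0 [N [tlt ha]]] f [M fM] fE.
pose t := Num.max 0 t0.
have t01 : 0 <= t < 1 by rewrite le_max lexx gt_max tlt ltr01.
have /andP[tp t1] := t01.
have at' (n : int) : n <= - N%:Z -> `|a n| <= t.
  by move=> /ha h; rewrite le_max h orbT.
have fk k (n : int) : n <= - N%:Z -> `|f n| <= t ^+ k * (M + 1).
  elim: k n => [|k IH] n nN; first by rewrite mul1r; exact: l2le_abs fM.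
  rewrite fE normrM exprS -mulrA; apply: ler_pM => //; first exact: at'.
  by apply: IH; lia.
have M1 : 0 < M + 1 by have := l2le_ge0 fM; lra.
have fz (n : int) : n <= - N%:Z -> f n = 0.
  move=> nN; apply/eqP; rewrite -normr_eq0; apply/eqP/le_anti; rewrite normr_ge0 andbT.
  apply/ler_addgt0Pr => e e0; rewrite add0r.
  have e1 : 0 < e / (M + 1) by rewrite divr_gt0.
  have [k /(_ k (leqnn k)) hk] := geometric_small t01 e1.
  by apply: le_trans (fk k n nN) _; rewrite -ler_pdivlMr // ltW.
move=> n; have [nN|nN] : n <= - N%:Z \/ - N%:Z <= n by lia.
  exact: fz.
move: n nN; apply: int_ind_up; first exact: fz.
by move=> n nN fn; rewrite fE addrK fn mulr0.
Qed.

(** The coefficient of the recursion satisfied by f_(-n), obtained by solving the equation at 1 - n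
    for its older term. An unstable end becomes a stable end on the other side. *)
Definition reverse a : int -> R := fun n => (a (1 - n))^-1.

Lemma normfV_le (x t : R) : 0 < t -> t <= `|x| -> `|x^-1| <= t^-1.
Proof. by move=> t0 tx; rewrite normfV lef_pV2 ?posrE // (lt_le_trans t0). Qed.

Lemma unstable_right_reverse a : unstable_right a -> stable_left (reverse a).
Proof.
move=> [t [N [t1 ha]]]; exists t^-1, N.+1; split; first by rewrite invf_lt1 //; lra.
by move=> n nN; apply: normfV_le; [lra|apply: ha; lia].
Qed.

Lemma unstable_left_reverse a : unstable_left a -> stable_right (reverse a).
Proof.
move=> [t [N [t1 ha]]]; exists t^-1, N.+1; split; first by rewrite invf_lt1 //; lra.
by move=> n nN; apply: normfV_le; [lra|apply: ha; lia].
Qed.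

(** Positive, bounded and bounded away from zero, so that the inverse, and with it [reverse a], is
    bounded too. *)
Definition pinched a : Prop :=
  exists lo hi : R, 0 < lo /\ forall n, lo <= a n <= hi.

Lemma pinched_gt0 a n : pinched a -> 0 < a n.
Proof. by move=> [lo [hi [lo0 /(_ n)]]]; lra. Qed.

Lemma pinched_neq0 a n : pinched a -> a n != 0.
Proof. by move=> /(@pinched_gt0 _ n)/gt_eqF ->. Qed.

Lemma pinched_bdd a : pinched a -> bdd a.
Proof.
move=> pa; have := fun n => pinched_gt0 n pa; case: pa => lo [hi [lo0 h]] a0.
by exists hi => n; rewrite gtr0_norm //; have := h n; lra.
Qed.

Lemma pinchedV a : pinched a -> pinched (fun n => (a n)^-1).
Proof.
move=> [lo [hi [lo0 h]]]; exists hi^-1, lo^-1; have := h 0 => h0.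
split; first by rewrite invr_gt0; lra.
by move=> n; have := h n => hn; rewrite !lef_pV2 ?posrE; lra.
Qed.

Lemma pinchedM a b : pinched a -> pinched b -> pinched (fun n => a n * b n).
Proof.
move=> [lo [hi [lo0 h]]] [lo' [hi' [lo0' h']]].
exists (lo * lo'), (hi * hi'); split; first exact: mulr_gt0.
move=> n; have := h n; have := h' n => hn hn'.
by apply/andP; split; apply: ler_pM; lra.
Qed.

Lemma pinched_reindex a (t : int -> int) : pinched a -> pinched (fun n => a (t n)).
Proof. by move=> [lo [hi [lo0 h]]]; exists lo, hi. Qed.

Lemma pinched_reverse a : pinched a -> pinched (reverse a).
Proof. by move=> /pinchedV; exact: (@pinched_reindex (fun n => (a n)^-1)). Qed.

Lemma reverse_equation a f g : (forall n, a n != 0) ->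
  (forall n, f n = a n * f (n - 1) + g n) <->
  (forall n, f (- n) = reverse a n * f (- (n - 1)) + - (reverse a n) * g (1 - n)).
Proof.
move=> a0; split=> h n.
  rewrite /reverse (_ : - (n - 1) = 1 - n); last by lia.
  by rewrite (h (1 - n)) (_ : 1 - n - 1 = - n); [field; exact: a0 | lia].
have := h (1 - n); rewrite /reverse (_ : 1 - (1 - n) = n); last by lia.
rewrite (_ : - (1 - n - 1) = n); last by lia.
rewrite (_ : - (1 - n) = n - 1); last by lia.
by move=> ->; field; exact: a0.
Qed.

Lemma unstable_right_injective a : pinched a -> unstable_right a ->
  first_order_injective a.
Proof.
move=> pa ua f fl fE n.
have h := stable_left_injective (unstable_right_reverse ua).
suff : f (0 - (- n)) = 0 by rewrite sub0r opprK.
apply: (h (fun n => f (0 - n)) (l2_reflect 0 fl)) => m.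
have fE0 k : f k = a k * f (k - 1) + 0 by rewrite addr0.
have := (reverse_equation f (fun=> 0) (fun n => pinched_neq0 n pa)).1 fE0 m.
by rewrite mulr0 addr0 !sub0r.
Qed.

(** Reflection reduces this to [stable_solvable]; the factor [B ^+ 2] accounts for the reversed
    source term. *)
Lemma unstable_solvable a : pinched a -> unstable_left a -> unstable_right a ->
  first_order_solvable a.
Proof.
move=> pa ul ur; have pr := pinched_reverse pa.
have [K K0 HK] := stable_solvable (pinched_bdd pr) (unstable_right_reverse ur)
  (unstable_left_reverse ul).
have [B rB] := pinched_bdd pr.
exists (K * B ^+ 2); first by rewrite mulr_ge0 // sqr_ge0.
move=> M g gM.
have gM' : l2le (fun n => - reverse a n * g (1 - n)) (B ^+ 2 * M).
  by apply: l2leM (l2le_reflect 1 gM) => n; rewrite normrN.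
have [f fM fE] := HK _ _ gM'.
exists (fun n => f (0 - n)); first by rewrite -mulrA; exact: l2le_reflect.
apply/(reverse_equation _ _ (fun n => pinched_neq0 n pa)) => n.
by rewrite !sub0r !opprK.
Qed.

(** From index [N] on, c_k^2 <= t gives (1 - t) x_k^2 <= x_k^2 - x_(k+1)^2, and the right side
    telescopes. *)
Lemma stable_decay (x c : nat -> R) (t : R) (N : nat) : t < 1 ->
  (forall k, x k.+1 = c k * x k) -> (forall k, (N <= k)%N -> `|c k| <= t) ->
  exists2 M, 0 <= M & forall k, \sum_(i < k) x i ^+ 2 <= M.
Proof.
move=> t1 xE cN; have t0 : 0 <= t := le_trans (normr_ge0 _) (cN N (leqnn N)).
have tail k : \sum_(i < k) x (N + i)%N ^+ 2 <= x N ^+ 2 / (1 - t).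
  suff : \sum_(i < k) x (N + i)%N ^+ 2 <= (x N ^+ 2 - x (N + k)%N ^+ 2) / (1 - t).
    move/le_trans; apply; apply: ler_wpM2r; first by rewrite invr_ge0; lra.
    by have := sqr_ge0 (x (N + k)%N); lra.
  elim: k => [|k IH]; first by rewrite big_ord0 addn0 subrr mul0r.
  rewrite big_ord_recr /= addnS xE.
  have h : c (N + k)%N ^+ 2 <= t.
    have := cN _ (leq_addr k N); rewrite -(real_normK (num_real (c _))).
    have := normr_ge0 (c (N + k)%N); nra.
  apply: le_trans (lerD IH (lexx _)) _.
  rewrite -subr_ge0.
  have E (u v : R) : (u - (c (N + k)%N * v) ^+ 2) / (1 - t) -
     ((u - v ^+ 2) / (1 - t) + v ^+ 2) = (t - c (N + k)%N ^+ 2) * v ^+ 2 / (1 - t).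
    by field; lra.
  rewrite E.
  by apply: divr_ge0; [apply: mulr_ge0; rewrite ?sqr_ge0 ?subr_ge0|lra].
exists (\sum_(i < N) x i ^+ 2 + x N ^+ 2 / (1 - t)).
  apply: addr_ge0; first by apply: sumr_ge0 => i _; exact: sqr_ge0.
  by rewrite mulr_ge0 ?sqr_ge0 // invr_ge0; lra.
move=> k; apply: (@le_trans _ _ (\sum_(i < N + k) x i ^+ 2)).
  rewrite addnC big_split_ord /= lerDl; apply: sumr_ge0 => i _; exact: sqr_ge0.
by rewrite big_split_ord lerD2l; exact: tail.
Qed.

Definition int_window (N : nat) : seq int :=
  [seq Posz i | i <- iota 0 N] ++ [seq Negz i | i <- iota 0 N].

Lemma int_window_uniq N : uniq (int_window N).
Proof.
rewrite cat_uniq !map_inj_uniq ?iota_uniq; try by move=> x y [].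
by rewrite andbT /=; apply/hasPn => x /mapP[i _ ->]; apply/mapP => -[].
Qed.

Lemma sum_int_window (F : int -> R) N :
  \sum_(n <- int_window N) F n = \sum_(i < N) (F (Posz i) + F (Negz i)).
Proof.
rewrite big_cat !big_map big_split /=.
by rewrite (_ : iota 0 N = index_iota 0 N) ?big_mkord // /index_iota subn0.
Qed.

Lemma sub_int_window (s : seq int) : exists N, {subset s <= int_window N}.
Proof.
elim: s => [|n s [N sN]]; first by exists 0%N.
exists (N + `|n|.+1)%N => m; rewrite inE mem_cat => mE.
have [k km] : exists k, (k < N + `|n|.+1)%N /\ (m = Posz k \/ m = Negz k).
  case/orP: mE => [/eqP ->|/sN].
    by case: n => k; exists k; split; [lia|left|lia|right].
  rewrite mem_cat => /orP[] /mapP[k]; rewrite mem_iota => kN ->; exists k; split.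
  - lia.
  - by left.
  - lia.
  - by right.
case: km => kN [] ->; apply/orP; [left|right]; apply/mapP; exists k => //;
  rewrite mem_iota; lia.
Qed.

Lemma sub_uniq_sum_le (F : int -> R) (s t : seq int) : (forall n, 0 <= F n) ->
  uniq s -> uniq t -> {subset s <= t} -> \sum_(n <- s) F n <= \sum_(n <- t) F n.
Proof.
move=> F0 us ut st; rewrite [leRHS](bigID (mem s)) /=.
have -> : \sum_(n <- t | n \in s) F n = \sum_(n <- s) F n.
  rewrite -big_filter; apply: perm_big; apply: uniq_perm => //.
    exact: filter_uniq.
  by move=> n; rewrite mem_filter; case sn : (n \in s) => //=; exact: st.
by rewrite lerDl; exact: sumr_ge0.
Qed.

(** Every finite list of indices lies in a window, and the terms are nonnegative. Pairing [Posz i]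
    with [Negz i] matches the series in [l2norm2]. *)
Lemma l2leP f (M : R) : l2le f M <->
  forall N, \sum_(i < N) (f (Posz i) ^+ 2 + f (Negz i) ^+ 2) <= M.
Proof.
split=> [fM N|fM s us].
  by rewrite -(sum_int_window (fun n => f n ^+ 2)); exact: fM (int_window_uniq N).
have [N sN] := sub_int_window s; apply: le_trans (fM N).
rewrite -(sum_int_window (fun n => f n ^+ 2)).
by apply: sub_uniq_sum_le (int_window_uniq N) sN => // n; exact: sqr_ge0.
Qed.

(** Induction away from site 0 in both directions; going left divides by the nonzero coefficient. *)
Lemma first_order_unique a f h : (forall n, a n != 0) ->
  (forall n, f n = a n * f (n - 1)) -> (forall n, h n = a n * h (n - 1)) ->
  h 0 = 1 -> forall n, f n = f 0 * h n.
Proof.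
move=> a0 fE hE h0 n.
have [n0|n0] : 0 <= n \/ 0 <= - n by lia.
  move: n n0; apply: int_ind_up; first by rewrite h0 mulr1.
  by move=> n n0 IH; rewrite fE hE addrK IH mulrCA.
rewrite -[n]opprK; move: (- n) n0; apply: int_ind_up; first by rewrite h0 mulr1.
move=> m m0; rewrite fE [h _]hE (_ : - m - 1 = - (m + 1)); last by lia.
by rewrite mulrCA => /(mulfI (a0 _)).
Qed.

Lemma first_order_kernel a : pinched a -> unstable_left a -> stable_right a ->
  exists h, [/\ l2 h, h 0 = 1 & forall n, h n = a n * h (n - 1)].
Proof.
move=> pa [tl [Nl [tl1 hl]]] [tr [Nr [tr1 hr]]].
have an0 n := pinched_neq0 n pa.
(* [hp k] is the value at k and [hn k] the value at -k, products of coefficients and of their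
   inverses. As [Negz k] is -(k + 1), it reads [hn] at k + 1. *)
pose hp := fix hp (k : nat) : R := if k is k'.+1 then a k'.+1%:Z * hp k' else 1.
pose hn := fix hn (k : nat) : R := if k is k'.+1 then (a (- k'%:Z))^-1 * hn k' else 1.
pose h (n : int) : R := match n with Posz k => hp k | Negz k => hn k.+1 end.
exists h; split => //; last first.
  case=> [[|k]|k].
  - by rewrite /= oppr0 mulr1 mulfV.
  - by rewrite (_ : k.+1%:Z - 1 = k%:Z) //; lia.
  - rewrite (_ : Negz k - 1 = Negz k.+1) /=; last by lia.
    by rewrite NegzE mulVKf.
have [Mp Mp0 hMp] : exists2 M, 0 <= M & forall k, \sum_(i < k) hp i ^+ 2 <= M.
  apply: (@stable_decay hp (fun k => a k.+1%:Z) tr Nr) => // k kN; apply: hr; lia.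
have [Mn Mn0 hMn] : exists2 M, 0 <= M & forall k, \sum_(i < k) hn i ^+ 2 <= M.
  apply: (@stable_decay hn (fun k => (a (- k%:Z))^-1) tl^-1 Nl) => //.
    by rewrite invf_lt1 //; lra.
  by move=> k kN; apply: normfV_le; [lra|apply: hl; lia].
exists (Mp + Mn); apply/l2leP => N; rewrite big_split; apply: lerD; first exact: hMp.
by apply: le_trans (hMn N.+1); rewrite [leRHS]big_ord_recl lerDr sqr_ge0.
Qed.

End FirstOrderTheory.

(** * Coefficients that are constant near each end *)

Section EventuallyConstant.
Variable R : realType.
Implicit Types (f g : int -> R).

Definition ends f (xl xr : R) : Prop := exists N : nat, forall n : int,
  (n <= - N%:Z -> f n = xl) /\ (N%:Z <= n -> f n = xr).

Lemma endsM f g xl xr yl yr : ends f xl xr -> ends g yl yr ->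
  ends (fun n => f n * g n) (xl * yl) (xr * yr).
Proof.
move=> [N fN] [N' gN]; exists (N + N')%N => n.
have [f1 f2] := fN n; have [g1 g2] := gN n.
by split=> h; [rewrite f1 ?g1|rewrite f2 ?g2] => //; lia.
Qed.

Lemma endsV f xl xr : ends f xl xr -> ends (fun n => (f n)^-1) xl^-1 xr^-1.
Proof.
move=> [N fN]; exists N => n; have [f1 f2] := fN n.
by split=> h; [rewrite f1|rewrite f2].
Qed.

Lemma ends2 f g xl xr yl yr : ends f xl xr -> ends g yl yr ->
  exists N : nat, forall n : int, (n <= - N%:Z -> f n = xl /\ g n = yl) /\
    (N%:Z <= n -> f n = xr /\ g n = yr).
Proof.
move=> [N fN] [N' gN]; exists (N + N')%N => n.
have [f1 f2] := fN n; have [g1 g2] := gN n.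
by split=> h; [rewrite f1 ?g1|rewrite f2 ?g2] => //; lia.
Qed.

Lemma ends_shift f xl xr (k : int) : ends f xl xr -> ends (fun n => f (n + k)) xl xr.
Proof.
move=> [N fN]; exists (N + `|k|)%N => n; have [f1 f2] := fN (n + k).
by split=> h; [apply: f1|apply: f2]; lia.
Qed.

Lemma ends_reflect f xl xr (k : int) : ends f xl xr -> ends (fun n => f (k - n)) xr xl.
Proof.
move=> [N fN]; exists (N + `|k|)%N => n; have [f1 f2] := fN (k - n).
by split=> h; [apply: f2|apply: f1]; lia.
Qed.

(** Only finitely many values occur: the two end values are already attained at the border of the
    window, where minimum and maximum are taken. *)
Lemma ends_pinched f xl xr : (forall n, 0 < f n) -> ends f xl xr -> pinched f.
Proof.
move=> f0 [N fN].
have [lo [hi [lo0 h]]] : exists lo hi : R, 0 < lo /\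
    forall n : int, - N%:Z <= n <= N%:Z -> lo <= f n <= hi.
  elim: N {fN} => [|N [lo [hi [lo0 h]]]].
    by exists (f 0), (f 0); split=> // n n0; rewrite (_ : n = 0) ?lexx //; lia.
  exists (Num.min lo (Num.min (f N.+1%:Z) (f (- N.+1%:Z)))).
  exists (Num.max hi (Num.max (f N.+1%:Z) (f (- N.+1%:Z)))).
  split; first by rewrite !lt_min lo0 !f0.
  move=> n nN; rewrite !ge_min !le_max.
  have [nN'|[->|->]] : (- N%:Z <= n <= N%:Z) \/ (n = N.+1%:Z \/ n = - N.+1%:Z) by lia.
  - by have /andP[-> ->] := h n nN'.
  - by rewrite !lexx !orbT.
  - by rewrite !lexx !orbT.
exists lo, hi; split=> // n.
have [nN|[nN|nN]] : (- N%:Z <= n <= N%:Z) \/ (n <= - N%:Z \/ N%:Z <= n) by lia.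
- exact: h.
- by rewrite (fN n).1 // -((fN (- N%:Z)).1 (lexx _)); apply: h; lia.
- by rewrite (fN n).2 // -((fN N%:Z).2 (lexx _)); apply: h; lia.
Qed.

Lemma ends_stable_right f xl xr : ends f xl xr -> `|xr| < 1 -> stable_right f.
Proof.
by move=> [N fN] x1; exists `|xr|, N; split=> // n nN; rewrite (fN n).2.
Qed.

Lemma ends_stable_left f xl xr : ends f xl xr -> `|xl| < 1 -> stable_left f.
Proof.
by move=> [N fN] x1; exists `|xl|, N; split=> // n nN; rewrite (fN n).1.
Qed.

Lemma ends_unstable_right f xl xr : ends f xl xr -> 1 < `|xr| -> unstable_right f.
Proof.
by move=> [N fN] x1; exists `|xr|, N; split=> // n nN; rewrite (fN n).2.
Qed.

Lemma ends_unstable_left f xl xr : ends f xl xr -> 1 < `|xl| -> unstable_left f.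
Proof.
by move=> [N fN] x1; exists `|xl|, N; split=> // n nN; rewrite (fN n).1.
Qed.

End EventuallyConstant.

(** * The Riccati recursion and its characteristic roots *)

Section Riccati.
Variable R : realType.
Implicit Types (al be u v : int -> R).

(** [x] is the positive root. The roots sum to r^2 / 2 and have negative product, so x - r^2 / 2 is
    the modulus of the other root. *)
Lemma characteristic_root (r : R) : 0 < r -> exists x : R,
  [/\ 0 < x, 2 * x ^+ 2 = r ^+ 2 * x + r, x - r ^+ 2 / 2 < 1,
      (r < 1 -> x < 1) & (1 < r -> 1 < x)].
Proof.
move=> r0; pose D := r ^+ 4 + 8 * r.
have D0 : 0 <= D by rewrite addr_ge0 ?exprn_ge0 // ?mulr_ge0 // ltW.
pose x := (r ^+ 2 + Num.sqrt D) / 4.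
have xp : 0 < x by rewrite divr_gt0 // ltr_pwDl ?sqrtr_ge0 // exprn_gt0.
have xE : 2 * x ^+ 2 = r ^+ 2 * x + r.
  have := sqr_sqrtr D0; rewrite /x; move: (Num.sqrt D) => s; rewrite /D => sE.
  have -> : 2 * ((r ^+ 2 + s) / 4) ^+ 2 = (r ^+ 4 + 2 * r ^+ 2 * s + s ^+ 2) / 8.
    by field.
  by rewrite sE; field.
exists x; split=> //.
- rewrite ltNge; apply/negP => h.
  (* By the quadratic equation this product equals (r - r^2 - 2) / 2, which is negative. *)
  have : 0 <= (x - r ^+ 2 / 2 - 1) * (x + 1) by apply: mulr_ge0; lra.
  nra.
- move=> r1; rewrite ltNge; apply/negP => h.
  have : 0 <= (1 - r ^+ 2) * x by apply: mulr_ge0; nra.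
  have : 0 <= x * (x - 1) by apply: mulr_ge0; lra.
  nra.
- move=> r1; rewrite ltNge; apply/negP => h.
  have : 0 <= (1 - x) * x by apply: mulr_ge0; lra.
  have : 0 <= (r ^+ 2 - 1) * x by apply: mulr_ge0; nra.
  nra.
Qed.

Lemma riccati_fixpoint (r x : R) : 0 < x -> 2 * x ^+ 2 = r ^+ 2 * x + r ->
  x = r ^+ 2 / 2 + r / (2 * x).
Proof.
move=> x0 xE; have x20 : 2 * x != 0 by rewrite mulf_neq0 ?gt_eqF.
by apply: (mulIf x20); rewrite [RHS]mulrDl divfK //; lra.
Qed.

(** One step multiplies the error by -r / (2 y_k x), which need not contract. Over two steps y_(k+1)
    y_k >= r / 2 bounds the factor by q = r / (2 x^2), and q < 1 since 2 x^2 = r^2 x + r. Even and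
    odd indices are then treated separately. *)
Lemma riccati_cvg (r x : R) (y : nat -> R) : 0 < r -> 0 < x ->
  2 * x ^+ 2 = r ^+ 2 * x + r -> (forall k, 0 < y k) ->
  (forall k, y k.+1 = r ^+ 2 / 2 + r / (2 * y k)) ->
  forall e : R, 0 < e -> exists K : nat, forall k, (K <= k)%N -> `|y k - x| <= e.
Proof.
move=> r0 x0 xE y0 yE e e0.
pose q := r / (2 * x ^+ 2).
have q01 : 0 <= q < 1.
  have xx : 0 < 2 * x ^+ 2 by rewrite mulr_gt0 // exprn_gt0.
  rewrite divr_ge0 ?ltW //= ltr_pdivrMr // mul1r xE.
  by rewrite ltrDr mulr_gt0 // exprn_gt0.
have step k : y k.+1 - x = - (r / (2 * y k * x)) * (y k - x).
  rewrite yE {1}(riccati_fixpoint x0 xE); field; rewrite !gt_eqF //.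
have step2 k : `|y k.+2 - x| <= q * `|y k - x|.
  rewrite step step mulrA normrM; apply: ler_wpM2r => //.
  have yy : y k.+1 * y k = (r ^+ 2 * y k + r) / 2.
    by rewrite yE; field; rewrite gt_eqF.
  have yk := y0 k; have yk1 := y0 k.+1.
  rewrite mulrNN ger0_norm; last by rewrite mulr_ge0 // divr_ge0 // ?mulr_ge0 // ltW.
  have -> : r / (2 * y k.+1 * x) * (r / (2 * y k * x)) =
            q * (r / (2 * (y k.+1 * y k))).
    by rewrite /q; field; rewrite !gt_eqF.
  have /andP[q0 _] := q01; apply: ler_piMr => //.
  rewrite ler_pdivrMr ?mul1r; last by rewrite mulr_gt0 // mulr_gt0.
  rewrite yy mulrCA mulfV // mulr1 lerDr; apply: mulr_ge0; rewrite ?sqr_ge0 // ltW //.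
pose B := `|y 0%N - x| + `|y 1%N - x| + 1.
have B0 : 0 < B by rewrite ltr_wpDl // addr_ge0.
have bnd k : `|y (k.*2)%N - x| <= q ^+ k * B /\ `|y (k.*2).+1%N - x| <= q ^+ k * B.
  have /andP[q0 _] := q01.
  elim: k => [|k [IH1 IH2]].
    rewrite expr0 mul1r /B; split.
      by rewrite -addrA lerDl addr_ge0.
    by rewrite addrAC lerDr addr_ge0.
  rewrite doubleS exprS -mulrA; split.
    by apply: le_trans (step2 _) _; apply: ler_wpM2l.
  by apply: le_trans (step2 _) _; apply: ler_wpM2l.
have eB : 0 < e / B by rewrite divr_gt0.
have [N hN] := geometric_small q01 eB.
exists N.*2 => k kN.
have h : q ^+ k./2 * B <= e.
  by rewrite -ler_pdivlMr // ltW // hN // geq_half_double.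
rewrite -(odd_double_half k); have [b1 b2] := bnd k./2.
by case: (odd k) => /=; rewrite ?add1n ?add0n; apply: le_trans h.
Qed.

(* The ratios u of a positive solution factor the second order operator:
   q_n - (al_n q_(n-1) + be_n q_(n-2)) / 2 = (1 + v S)(1 - u S) q, with S the
   shift. Starting the Riccati recursion at the dominant characteristic root of
   the left end makes u constant there, and u tends to the dominant root of the
   right end; v tends to minus the other root, of modulus < 1 in all cases. *)
Lemma riccati_factorization al be (rl rr : R) : 0 < rl -> 0 < rr ->
  (forall n, 0 < al n) -> (forall n, 0 < be n) ->
  ends al (rl ^+ 2) (rr ^+ 2) -> ends be rl rr ->
  exists u v,
  [/\ pinched u, pinched v,
      (forall n, u n = al n / 2 + v n /\ v n * u (n - 1) = be n / 2),
      stable_left v /\ stable_right v &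
      [/\ (rl < 1 -> stable_left u), (1 < rl -> unstable_left u),
          (rr < 1 -> stable_right u) & (1 < rr -> unstable_right u)]].
Proof.
move=> rl0 rr0 al0 be0 eal ebe.
have [x [x0 xE x2 xlt xgt]] := characteristic_root rl0.
have [z [z0 zE z2 zlt zgt]] := characteristic_root rr0.
have pal := ends_pinched al0 eal; have pbe := ends_pinched be0 ebe.
have [N hN] := ends2 eal ebe.
have alL (n : int) : n <= - N%:Z -> al n = rl ^+ 2 by move=> /(hN n).1[].
have alR (n : int) : N%:Z <= n -> al n = rr ^+ 2 by move=> /(hN n).2[].
have beL (n : int) : n <= - N%:Z -> be n = rl by move=> /(hN n).1[].
have beR (n : int) : N%:Z <= n -> be n = rr by move=> /(hN n).2[].
(* [U k] is the ratio at site k - N. Further left [u] keeps the value [x], a fixed point of the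
   recursion there. *)
pose U := fix U (k : nat) : R := if k is k'.+1 then
  al (k'.+1%:Z - N%:Z) / 2 + be (k'.+1%:Z - N%:Z) / (2 * U k') else x.
pose u (n : int) := if n <= - N%:Z then x else U `|(n + N%:Z)%R|%N.
pose v n := be n / (2 * u (n - 1)).
have U0 k : 0 < U k.
  elim: k => [//|k IH] /=; apply: addr_gt0; apply: divr_gt0 => //.
  exact: mulr_gt0.
have u0 n : 0 < u n by rewrite /u; case: ifP.
have uE n : u n = al n / 2 + v n.
  rewrite /v /u; case: ifP => nN.
    rewrite ifT; last by clear -nN; lia.
    by rewrite alL // beL //; exact: riccati_fixpoint.
  have [k nk] : exists k : nat, n = k.+1%:Z - N%:Z.
    by exists (`|(n + N%:Z)%R|.-1)%N; clear -nN; lia.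
  have -> : `|(n + N%:Z)%R|%N = k.+1 by clear -nk; lia.
  rewrite /= -nk; congr (_ + _ / (2 * _)); case: ifP => h.
    by have -> : k = 0%N by clear -nk h; lia.
  by congr U; clear -nk h; lia.
have v0 n : 0 < v n by rewrite divr_gt0 // mulr_gt0.
have vu n : v n * u (n - 1) = be n / 2.
  by rewrite /v; field; rewrite gt_eqF.
(* The bounds chain: v > 0 bounds u below, hence v above, hence u above, hence v below. *)
have pv : pinched v.
  case: pal pbe => [lo [hi [lo0 hal]]] [lo' [hi' [lo0' hbe]]].
  have ulo n : lo / 2 <= u n.
    by rewrite uE; have := v0 n; have := hal n; lra.
  have vhi n : v n <= hi' / lo.
    rewrite ler_pdivlMr //; have := vu n; have := ulo (n - 1); have := hbe n.
    have := v0 n; nra.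
  have uhi n : u n <= hi / 2 + hi' / lo.
    by rewrite uE; have := vhi n; have := hal n; lra.
  have H0 : 0 < hi / 2 + hi' / lo by apply: lt_le_trans (uhi 0).
  exists (lo' / (2 * (hi / 2 + hi' / lo))), (hi' / lo); split.
    by rewrite divr_gt0 // mulr_gt0.
  move=> n; rewrite vhi andbT ler_pdivrMr; last by rewrite mulr_gt0.
  have := vu n; have := uhi (n - 1); have := hbe n; have := v0 n; nra.
have pu : pinched u.
  case: pal pv => [lo [hi [lo0 hal]]] [lo' [hi' [lo0' hv]]].
  exists (lo / 2 + lo'), (hi / 2 + hi'); split; first by lra.
  by move=> n; rewrite uE; have := hal n; have := hv n; lra.
have ucv (e : R) : 0 < e -> exists K : nat, forall n : int, K%:Z <= n -> `|u n - z| <= e.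
  move=> e0.
  have yE k : u (N%:Z + k.+1%:Z) = rr ^+ 2 / 2 + rr / (2 * u (N%:Z + k%:Z)).
    rewrite uE /v alR ?beR; [|by clear; lia|by clear; lia].
    by congr (_ + _ / (2 * u _)); clear; lia.
  have [K hK] := riccati_cvg (y := fun k => u (N%:Z + k%:Z)) rr0 z0 zE (fun k => u0 _) yE e0.
  exists (N + K)%N => n nK; have := hK `|n - N%:Z|%N.
  rewrite (_ : N%:Z + `|n - N%:Z|%N%:Z = n); last by clear -nK; lia.
  by apply; clear -nK; lia.
exists u, v; split=> //; split.
- exists (x - rl ^+ 2 / 2), N; split=> // n nN.
  have := uE n; rewrite gtr0_norm // {1}/u nN alL //; lra.
(* The tolerance is half the gap between the limit of v and 1, so the midpoint serves as rate; the
   same choice is made for u below. *)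
- have [K hK] := ucv ((1 - (z - rr ^+ 2 / 2)) / 2) ltac:(lra).
  exists ((1 + (z - rr ^+ 2 / 2)) / 2), (N + K)%N; split; first by lra.
  move=> n nN; have := hK n ltac:(clear -nN; lia); rewrite ler_norml gtr0_norm // uE alR; last by clear -nN; lia.
  lra.
- by move=> /xlt x1; exists x, N; split=> // n nN; rewrite /u nN gtr0_norm.
- by move=> /xgt x1; exists x, N; split=> // n nN; rewrite /u nN gtr0_norm.
- move=> /zlt z1; have [K hK] := ucv ((1 - z) / 2) ltac:(lra).
  exists ((1 + z) / 2), K; split; first by lra.
  by move=> n nN; have := hK n nN; rewrite ler_norml gtr0_norm //; lra.
- move=> /zgt z1; have [K hK] := ucv ((z - 1) / 2) ltac:(lra).
  exists ((1 + z) / 2), K; split; first by lra.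
  by move=> n nN; have := hK n nN; rewrite ler_norml gtr0_norm //; lra.
Qed.

End Riccati.

(** * Second order recursions through their two first order factors *)

Section SecondOrder.
Variable R : realType.
Implicit Types (f g q al be u v : int -> R).

Definition riccati_pair al be u v : Prop :=
  forall n, u n = al n / 2 + v n /\ v n * u (n - 1) = be n / 2.

Lemma second_order_factor al be u v q (F : R) (n : int) : riccati_pair al be u v ->
  q n = (al n * q (n - 1) + be n * q (n - 2)) / 2 + F <->
  q n - u n * q (n - 1) = - v n * (q (n - 1) - u (n - 1) * q (n - 1 - 1)) + F.
Proof.
move=> uv; have [un vn] := uv n.
have -> : n - 1 - 1 = n - 2 by lia.
have -> : - v n * (q (n - 1) - u (n - 1) * q (n - 2)) =
    - v n * q (n - 1) + be n / 2 * q (n - 2) by rewrite -vn; ring.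
by rewrite un; split=> h; lra.
Qed.

(** The outer factor is solved for g_n = q_n - u_n q_(n-1), then the inner one for q; the constants
    multiply. *)
Lemma second_order_solvable al be u v : riccati_pair al be u v ->
  first_order_solvable (fun n => - v n) -> first_order_solvable u ->
  exists K : R, forall M F, l2le F M -> exists2 q, l2le q (K * M) &
    forall n, q n = (al n * q (n - 1) + be n * q (n - 2)) / 2 + F n.
Proof.
move=> uv [K1 _ H1] [K2 _ H2]; exists (K2 * K1) => M F FM.
have [g gM gE] := H1 _ _ FM.
have [q qM qE] := H2 _ _ gM.
exists q; first by rewrite -mulrA.
move=> n; apply/(second_order_factor _ _ _ uv).
have e m : q m - u m * q (m - 1) = g m by rewrite {1}qE; ring.
by rewrite !e.
Qed.

(** q_n - u_n q_(n-1) is in l^2 because [u] is bounded, and the outer factor has no kernel there. *)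
Lemma second_order_injective al be u v q : riccati_pair al be u v -> bdd u ->
  first_order_injective (fun n => - v n) -> l2 q ->
  (forall n, q n = (al n * q (n - 1) + be n * q (n - 2)) / 2) ->
  forall n, q n = u n * q (n - 1).
Proof.
move=> uv bu vi ql qE n; apply/eqP; rewrite -subr_eq0; apply/eqP.
apply: (vi (fun n => q n - u n * q (n - 1))) => [|m].
  apply: (@eq_l2 _ (fun n => q n + (-1) * (u n * q (n - 1)))).
    by move=> m; rewrite mulN1r.
  by apply: l2D => //; apply: l2Z; apply: l2M => //; exact: l2_shift.
rewrite -[RHS]addr0; apply/(second_order_factor _ _ _ uv).
by rewrite addr0.
Qed.

End SecondOrder.

(** * Bounds of the form constant times data *)

Section UniformBounds.
Variable R : realType.
Implicit Types (f g a : int -> R) (K M : R).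

(** The shape [K * M] lets unification assemble the constant of the block inverse, independent of
    the data. *)
Lemma l2leDK f g K K' M : l2le f (K * M) -> l2le g (K' * M) ->
  l2le (fun n => f n + g n) ((2 * K + 2 * K') * M).
Proof. by rewrite mulrDl -!mulrA; exact: l2leD. Qed.

Lemma l2leZK f (B : R) K M : l2le f (K * M) ->
  l2le (fun n => B * f n) ((B ^+ 2 * K) * M).
Proof. by rewrite -mulrA; exact: l2leZ. Qed.

Lemma l2leMK a f (B : R) K M : (forall n, `|a n| <= B) -> l2le f (K * M) ->
  l2le (fun n => a n * f n) ((B ^+ 2 * K) * M).
Proof. by rewrite -mulrA; exact: l2leM. Qed.

Lemma l2leBK f g K K' M : l2le f (K * M) -> l2le g (K' * M) ->
  l2le (fun n => f n - g n) ((2 * K + 2 * K') * M).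
Proof.
move=> fM /(l2leZK (-1)); rewrite sqrrN expr1n mul1r => /(l2leDK fM).
by rewrite (_ : (fun n => _) = fun n => f n - g n) //; apply/funext => n; rewrite mulN1r.
Qed.

Lemma l2le_maxl f K K' M : 0 <= M -> l2le f (K * M) -> l2le f (Num.max K K' * M).
Proof. by move=> M0; apply: l2le_mono; rewrite ler_wpM2r // le_max lexx. Qed.

Lemma l2le_maxr f K K' M : 0 <= M -> l2le f (K' * M) -> l2le f (Num.max K K' * M).
Proof. by move=> M0; apply: l2le_mono; rewrite ler_wpM2r // le_max lexx orbT. Qed.

End UniformBounds.

(** * The off-diagonal block: reduction, inversion and zero modes *)

Section OffDiagonalBlock.
Variable R : realType.
Implicit Types (b c D p q r y : int -> R).

(* One of the two off-diagonal blocks of -H(0); the other one has the same form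
   after the reflection n -> -n. *)
Definition block b c D p q r y1 y2 y3 : Prop := forall n : int,
  [/\ b n * p n + b n * q n + c n * r (n + 1) = y1 n,
      b n * p n + D n * q (n - 2) + b n * r n = y2 n &
      c n * p (n + 1) + b n * q n + b n * r n = y3 n].

Definition block_coef b c D (bl br gl gr : R) : Prop :=
  [/\ (forall n, 0 < b n), (forall n, 0 < c n), (forall n, 0 < D n),
      [/\ 0 < bl, 0 < br, 0 < gl & 0 < gr] &
      [/\ ends b bl br, ends c gl gr & ends D gl gr]].

Definition blk_a b c (n : int) : R := b (n - 1) * (c (n - 1))^-1.
Definition blk_al b c D (n : int) : R :=
  c n * D (n + 1) * ((b n)^-1 * (b (n + 1))^-1).
Definition blk_be b D (n : int) : R := D n * (b n)^-1.

(** Row three minus row one involves only p - r. Row two gives p + r in terms of q, and inserting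
    this into the sum of rows one and three leaves an equation for q alone. *)
Lemma block_reduce b c D p q r y1 y2 y3 :
  (forall n, 0 < b n) -> (forall n, 0 < c n) ->
  block b c D p q r y1 y2 y3 <->
  [/\ forall n, p n - r n = blk_a b c n * (p (n - 1) - r (n - 1)) +
        (c (n - 1))^-1 * (y3 (n - 1) - y1 (n - 1)),
      forall n, p n + r n = (b n)^-1 * y2 n - blk_be b D n * q (n - 2) &
      forall n, q n = (blk_al b c D n * q (n - 1) + blk_be b D n * q (n - 2)) / 2 +
        (2 * b n)^-1 * (y1 n + y3 n - y2 n - c n * (b (n + 1))^-1 * y2 (n + 1))].
Proof.
move=> b0' c0'; have b0 n : b n != 0 by rewrite gt_eqF.
have c0 n : c n != 0 by rewrite gt_eqF.
have tE : (forall n, b n * p n + D n * q (n - 2) + b n * r n = y2 n) <->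
    (forall n, p n + r n = (b n)^-1 * y2 n - blk_be b D n * q (n - 2)).
  split=> h n.
    by rewrite -h /blk_be; field.
  have -> : b n * p n + D n * q (n - 2) + b n * r n =
    b n * (p n + r n) + D n * q (n - 2) by ring.
  by rewrite h /blk_be; field.
split=> [h|[hs ht hq]].
  have h2 n : b n * p n + D n * q (n - 2) + b n * r n = y2 n by case: (h n).
  split; last 1 first.
  - move=> n; have [e1 _ e3] := h n; rewrite -e1 -e3 -!h2.
    rewrite (_ : n + 1 - 2 = n - 1); last by clear; lia.
    by rewrite /blk_al /blk_be; field; rewrite !b0.
  - move=> n; have [e1 _ e3] := h (n - 1); rewrite -e1 -e3 /blk_a subrK.
    by field.
  - exact/tE.
have h2 := tE.2 ht.
have hd n : c n * (p (n + 1) - r (n + 1)) = b n * (p n - r n) + (y3 n - y1 n).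
  by rewrite hs /blk_a addrK; field.
have hsum n : b n * (p n + r n) + 2 * (b n * q n) + c n * (p (n + 1) + r (n + 1)) =
    y1 n + y3 n.
  rewrite !ht [in 2 * _]hq /blk_al /blk_be.
  rewrite (_ : n + 1 - 2 = n - 1); last by clear; lia.
  by field; rewrite !b0.
move=> n; split; last 1 first.
- by have := hd n; have := hsum n; lra.
- by have := hd n; have := hsum n; lra.
- exact: h2.
Qed.

Section Coefficients.
Variables (b c D : int -> R) (bl br gl gr : R).
Hypothesis coef : block_coef b c D bl br gl gr.

Let b0 n : 0 < b n. Proof. by case: coef. Qed.
Let c0 n : 0 < c n. Proof. by case: coef. Qed.
Let D0 n : 0 < D n. Proof. by case: coef. Qed.
Let ends0 : [/\ 0 < bl, 0 < br, 0 < gl & 0 < gr]. Proof. by case: coef. Qed.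
Let eb : ends b bl br. Proof. by case: coef => _ _ _ _ []. Qed.
Let ec : ends c gl gr. Proof. by case: coef => _ _ _ _ []. Qed.
Let eD : ends D gl gr. Proof. by case: coef => _ _ _ _ []. Qed.
Let pb : pinched b. Proof. exact: ends_pinched eb. Qed.
Let pc : pinched c. Proof. exact: ends_pinched ec. Qed.
Let pD : pinched D. Proof. exact: ends_pinched eD. Qed.

Let ea : ends (blk_a b c) (bl / gl) (br / gr).
Proof. by apply: endsM; [|apply: endsV]; exact: ends_shift. Qed.

Let pa : pinched (blk_a b c).
Proof. by apply: ends_pinched ea => n; rewrite mulr_gt0 ?invr_gt0. Qed.

Let ebe : ends (blk_be b D) (gl / bl) (gr / br).
Proof. by apply: endsM => //; exact: endsV. Qed.

Let pbe : pinched (blk_be b D).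
Proof. by apply: ends_pinched ebe => n; rewrite mulr_gt0 ?invr_gt0. Qed.

Let eal : ends (blk_al b c D) ((gl / bl) ^+ 2) ((gr / br) ^+ 2).
Proof.
rewrite !expr2 ![_ / _ * (_ / _)]mulrACA.
apply: endsM; first by apply: endsM => //; exact: ends_shift.
by apply: endsM; apply: endsV => //; exact: ends_shift.
Qed.

Let riccati : exists u v : int -> R,
  [/\ riccati_pair (blk_al b c D) (blk_be b D) u v, pinched u,
      first_order_solvable (fun n => - v n), first_order_injective (fun n => - v n) &
      [/\ (gl < bl -> stable_left u), (bl < gl -> unstable_left u),
          (gr < br -> stable_right u) & (br < gr -> unstable_right u)]].
Proof.
have [bl0 br0 gl0 gr0] := ends0.
have [u [v [pu pv uv [vl vr] [h1 h2 h3 h4]]]] := riccati_factorization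
  (divr_gt0 gl0 bl0) (divr_gt0 gr0 br0)
  (fun n => mulr_gt0 (mulr_gt0 (c0 n) (D0 (n + 1)))
     (mulr_gt0 (etrans (invr_gt0 _) (b0 n)) (etrans (invr_gt0 _) (b0 (n + 1)))))
  (fun n => mulr_gt0 (D0 n) (etrans (invr_gt0 _) (b0 n))) eal ebe.
have vl' : stable_left (fun n => - v n).
  by case: vl => t [N [t1 h]]; exists t, N; split=> // n nN; rewrite normrN; exact: h.
have vr' : stable_right (fun n => - v n).
  by case: vr => t [N [t1 h]]; exists t, N; split=> // n nN; rewrite normrN; exact: h.
exists u, v; split=> //.
- apply: stable_solvable => //; have [B hB] := pinched_bdd pv.
  by exists B => n; rewrite normrN.
- exact: stable_left_injective.
- split=> h.
  + by apply: h1; rewrite ltr_pdivrMr // mul1r.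
  + by apply: h2; rewrite ltr_pdivlMr // mul1r.
  + by apply: h3; rewrite ltr_pdivrMr // mul1r.
  + by apply: h4; rewrite ltr_pdivlMr // mul1r.
Qed.

Let a_stable_left : bl < gl -> stable_left (blk_a b c).
Proof.
have [bl0 br0 gl0 gr0] := ends0; move=> h; apply: (ends_stable_left ea).
by rewrite gtr0_norm ?divr_gt0 // ltr_pdivrMr // mul1r.
Qed.

Let a_stable_right : br < gr -> stable_right (blk_a b c).
Proof.
have [bl0 br0 gl0 gr0] := ends0; move=> h; apply: (ends_stable_right ea).
by rewrite gtr0_norm ?divr_gt0 // ltr_pdivrMr // mul1r.
Qed.

Let a_unstable_left : gl < bl -> unstable_left (blk_a b c).
Proof.
have [bl0 br0 gl0 gr0] := ends0; move=> h; apply: (ends_unstable_left ea).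
by rewrite gtr0_norm ?divr_gt0 // ltr_pdivlMr // mul1r.
Qed.

Let a_unstable_right : gr < br -> unstable_right (blk_a b c).
Proof.
have [bl0 br0 gl0 gr0] := ends0; move=> h; apply: (ends_unstable_right ea).
by rewrite gtr0_norm ?divr_gt0 // ltr_pdivlMr // mul1r.
Qed.

Lemma block_l2 p q r y1 y2 y3 : block b c D p q r y1 y2 y3 ->
  l2 p -> l2 q -> l2 r -> [/\ l2 y1, l2 y2 & l2 y3].
Proof.
move=> h lp lq lr; split.
- apply: eq_l2 (l2D (l2D (l2M (pinched_bdd pb) lp) (l2M (pinched_bdd pb) lq))
    (l2M (pinched_bdd pc) (l2_shift 1 lr))) => n.
  by case: (h n).
- apply: eq_l2 (l2D (l2D (l2M (pinched_bdd pb) lp)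
    (l2M (pinched_bdd pD) (l2_shift (-2) lq))) (l2M (pinched_bdd pb) lr)) => n.
  by case: (h n).
- apply: eq_l2 (l2D (l2D (l2M (pinched_bdd pc) (l2_shift 1 lp))
    (l2M (pinched_bdd pb) lq)) (l2M (pinched_bdd pb) lr)) => n.
  by case: (h n).
Qed.

(** [gl - bl] and [gr - br] stand for the values of delta at the left and right end of the block. *)
Definition same_phase : Prop := (bl < gl /\ br < gr) \/ (gl < bl /\ gr < br).

Definition opposite_phase : Prop := (bl < gl /\ gr < br) \/ (gl < bl /\ br < gr).

(** In either case one of [blk_a] and [u] is stable at both ends and the other unstable at both, so
    both first order problems are solvable. *)
Lemma block_solvable : same_phase -> exists K : R, forall M y1 y2 y3,
  l2le y1 M -> l2le y2 M -> l2le y3 M ->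
  exists p q r, [/\ l2le p (K * M), l2le q (K * M), l2le r (K * M) &
    block b c D p q r y1 y2 y3].
Proof.
move=> phase; have [u [v [uv pu vs _ [u1 u2 u3 u4]]]] := riccati.
have as' : first_order_solvable (blk_a b c).
  case: phase => -[h1 h2].
    by apply: stable_solvable; [exact: pinched_bdd|exact: a_stable_left|exact: a_stable_right].
  by apply: unstable_solvable; [|exact: a_unstable_left|exact: a_unstable_right].
have us : first_order_solvable u.
  case: phase => -[h1 h2].
    by apply: unstable_solvable; [|exact: u2|exact: u4].
  by apply: stable_solvable; [exact: pinched_bdd|exact: u1|exact: u3].
have [Ks _ Hs] := as'; have [Kq Hq] := second_order_solvable uv vs us.
have [B1 h1] := pinched_bdd (pinched_reindex (fun n => n - 1) (pinchedV pc)).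
have [B2 h2] := pinched_bdd (pinchedV pb).
have [B3 h3] := pinched_bdd pbe.
have [B4 h4] := pinched_bdd (pinchedM pc (pinched_reindex (fun n => n + 1) (pinchedV pb))).
have [B5 h5] : bdd (fun n => (2 * b n)^-1).
  by exists (2^-1 * B2) => n; rewrite invfM normrM ger0_norm // ler_wpM2l.
(* The three constants stay open here and are filled in by the bounds [pM], [qM] and [rM]. *)
refine (ex_intro _ (Num.max _ (Num.max _ _)) _) => M y1 y2 y3 Y1 Y2 Y3.
have M0 := l2le_ge0 Y1.
rewrite -[M]mul1r in Y1 Y2 Y3.
have [s] := Hs _ _ (l2leMK h1 (l2le_shift (-1) (l2leBK Y3 Y1))).
rewrite mulrA => sM sE.
have [q] := Hq _ _ (l2leMK h5 (l2leBK (l2leBK (l2leDK Y1 Y3) Y2)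
  (l2leMK h4 (l2le_shift 1 Y2)))).
rewrite mulrA => qM qE.
have tM := l2leBK (l2leMK h2 Y2) (l2leMK h3 (l2le_shift (-2) qM)).
have pM := l2leZK 2^-1 (l2leDK tM sM); have rM := l2leZK 2^-1 (l2leBK tM sM).
eexists; exists q; eexists; split.
- exact: (l2le_maxl _ M0 pM).
- exact: (l2le_maxr _ M0 (l2le_maxl _ M0 qM)).
- exact: (l2le_maxr _ M0 (l2le_maxr _ M0 rM)).
apply/(block_reduce _ _ _ _ _ _ _ b0 c0); split=> n.
- have e (x y : R) : 2^-1 * (x + y) - 2^-1 * (x - y) = y by field.
  by rewrite /= !e; exact: sE.
- have e (x y : R) : 2^-1 * (x + y) + 2^-1 * (x - y) = x by field.
  by rewrite /= e.
- exact: qE.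
Qed.

Let homogeneous p q r : block b c D p q r (fun=> 0) (fun=> 0) (fun=> 0) <->
  [/\ forall n, p n - r n = blk_a b c n * (p (n - 1) - r (n - 1)),
      forall n, p n + r n = - (blk_be b D n * q (n - 2)) &
      forall n, q n = (blk_al b c D n * q (n - 1) + blk_be b D n * q (n - 2)) / 2].
Proof.
rewrite block_reduce //; split=> -[h1 h2 h3]; split=> n.
- by rewrite h1 subrr mulr0 addr0.
- by rewrite h2 mulr0 sub0r.
- by rewrite h3 addr0 !subr0 !mulr0 subr0 mulr0 addr0.
- by rewrite h1 subrr mulr0 addr0.
- by rewrite h2 mulr0 sub0r.
- by rewrite h3 addr0 !subr0 !mulr0 subr0 mulr0 addr0.
Qed.

Let l2B f g : l2 f -> l2 g -> l2 (fun n : int => f n - g n : R).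
Proof.
move=> lf lg; apply: (eq_l2 _ (l2D lf (l2Z (-1) lg))) => n.
by rewrite mulN1r.
Qed.

Lemma block_injective p q r : same_phase -> l2 p -> l2 q -> l2 r ->
  block b c D p q r (fun=> 0) (fun=> 0) (fun=> 0) ->
  forall n, [/\ p n = 0, q n = 0 & r n = 0].
Proof.
move=> phase lp lq lr /homogeneous[hs ht hq].
have [u [v [uv pu _ vi [u1 u2 u3 u4]]]] := riccati.
have ai : first_order_injective (blk_a b c).
  case: phase => -[h1 h2]; first by apply: stable_left_injective; exact: a_stable_left.
  by apply: unstable_right_injective => //; exact: a_unstable_right.
have ui : first_order_injective u.
  case: phase => -[h1 h2]; first by apply: unstable_right_injective => //; exact: u4.
  by apply: stable_left_injective; exact: u1.
have s0 := ai _ (l2B lp lr) hs.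
have q0 := ui _ lq (second_order_injective uv (pinched_bdd pu) vi lq hq).
move=> n; have := ht n; have := s0 n; rewrite /= !q0 mulr0 => e1 e2.
by split=> //; lra.
Qed.

(** Exactly one of the factors [blk_a] and [u] has a kernel, of dimension one, while the other is
    injective. The nonvanishing at site 0 later yields linear independence. *)
Lemma block_kernel : opposite_phase -> exists p0 q0 r0,
  [/\ [/\ l2 p0, l2 q0 & l2 r0],
      block b c D p0 q0 r0 (fun=> 0) (fun=> 0) (fun=> 0),
      p0 0 != 0 \/ q0 0 != 0 &
      forall p q r, l2 p -> l2 q -> l2 r ->
        block b c D p q r (fun=> 0) (fun=> 0) (fun=> 0) ->
        exists x : R, forall n,
          [/\ p n = x * p0 n, q n = x * q0 n & r n = x * r0 n]].
Proof.
move=> phase; have [u [v [uv pu _ vi [u1 u2 u3 u4]]]] := riccati.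
case: phase => -[h1 h2].
  (* Here p - r must vanish and the mode lives in q, with p = r determined by the second row. *)
  have ai := unstable_right_injective pa (a_unstable_right h2).
  have [h [lh h0 hE]] := first_order_kernel pu (u2 h1) (u3 h2).
  pose t n := - 2^-1 * (blk_be b D n * h (n - 2)).
  have lt : l2 t.
    by apply: l2Z; apply: l2M; [exact: pinched_bdd|exact: l2_shift].
  exists t, h, t; split=> //; last 2 first.
  - by right; rewrite h0 oner_neq0.
  - move=> p q r lp lq lr /homogeneous[hs ht hq].
    have s0 := ai _ (l2B lp lr) hs.
    have qE := second_order_injective uv (pinched_bdd pu) vi lq hq.
    have qh := first_order_unique (fun n => pinched_neq0 n pu) qE hE h0.
    exists (q 0) => n; have := s0 n; have := ht n; rewrite /= [q (n - 2)]qh => e1 e2.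
    by split; [rewrite /t; lra|exact: qh|rewrite /t; lra].
  apply/homogeneous; split=> n.
  - by rewrite !subrr mulr0.
  - by rewrite /t; lra.
  - rewrite -[RHS]addr0; apply/(second_order_factor _ _ _ uv).
    have e m : h m - u m * h (m - 1) = 0 by rewrite {1}hE subrr.
    by rewrite !e mulr0 addr0.
(* Here q must vanish, so p = -r, and the mode lives in p - r. *)
have ui := stable_left_injective (u1 h1).
have [h [lh h0 hE]] := first_order_kernel pa (a_unstable_left h1) (a_stable_right h2).
exists (fun n => 2^-1 * h n), (fun=> 0), (fun n => - 2^-1 * h n); split.
- by split; [exact: l2Z|exact: l2_0|exact: l2Z].
- apply/homogeneous; split=> n.
  + by rewrite !(_ : forall x : R, 2^-1 * x - - 2^-1 * x = x) // => x; field.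
  + by rewrite mulr0 oppr0 mulNr subrr.
  + by rewrite !mulr0 addr0 mul0r.
- by left; rewrite h0 mulr1 invr_eq0.
move=> p q r lp lq lr /homogeneous[hs ht hq].
have q0 := ui _ lq (second_order_injective uv (pinched_bdd pu) vi lq hq).
have sh := first_order_unique (f := fun n => p n - r n) (fun n => pinched_neq0 n pa) hs hE h0.
exists (p 0 - r 0) => n; have := ht n; have := sh n.
by rewrite /= !q0 !mulr0 oppr0 => e1 e2; split=> //; lra.
Qed.

End Coefficients.
End OffDiagonalBlock.

(** * From the real blocks to the complex Hamiltonian at k = 0 *)

Section Interface.
Variable R : realType.
Local Notation C := R[i].
Variables (bp bm dp dm c : R).
Hypotheses (bp0 : 0 < bp) (bm0 : 0 < bm) (gp0 : 0 < bp + dp) (gm0 : 0 < bm + dm).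
Hypothesis c0 : 0 < c.

Implicit Types (w : seq6 R) (x y : nat -> int -> R).

Let H := H_II bp bm dp dm c 0.
Let b := bcoef bp bm.
Let cc := ccoef bp bm dp dm c.
Let dd := dcoef bp bm dp dm c.

Definition upper_block (p q r y1 y2 y3 : int -> R) : Prop :=
  block b cc (fun n => dd (n - 2)) p q r y1 y2 y3.

(** Rows 4 to 6 couple to n - 1 and n + 2; the reflection turns these into n + 1 and n - 2 as in
    [block], and c_(n-1) read at -n is [cc (- 1 - n)]. It also exchanges the two ends. *)
Definition lower_block (p q r y1 y2 y3 : int -> R) : Prop :=
  block (fun n => b (0 - n)) (fun n => cc (- 1 - n)) (fun n => dd (0 - n))
    p q r y1 y2 y3.

Lemma upper_coef :
  block_coef b cc (fun n => dd (n - 2)) bm bp (bm + dm) (bp + dp).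
Proof.
split=> //.
- by move=> n; rewrite /b /bcoef; case: ifP.
- by move=> n; rewrite /cc /ccoef; case: ifP => // _; case: ifP.
- by move=> n; rewrite /dd /dcoef; case: ifP => // _; case: ifP.
split.
(* The thresholds 1, 2, 3 step over the interface: [cc] is exceptional at -1, [dd] at -1 and -2. *)
- exists 1%N => n; rewrite /b /bcoef; clear; split=> h; case: ifP => //; lia.
- exists 2%N => n; rewrite /cc /ccoef; clear; split=> h; case: ifP => //; try lia.
  by move=> _; case: ifP => //; lia.
- apply: (@ends_shift _ dd _ _ (-2)); exists 3%N => n; rewrite /dd /dcoef; clear.
  split=> h; case: ifP => //; try lia.
  by move=> _; case: ifP => //; lia.
Qed.

Lemma lower_coef : block_coef (fun n => b (0 - n)) (fun n => cc (- 1 - n))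
  (fun n => dd (0 - n)) bp bm (bp + dp) (bm + dm).
Proof.
have [hb hc hd _ [eb ec ed]] := upper_coef.
split=> //; first by move=> n; have := hd (0 - n + 2); rewrite addrK.
split; [exact: ends_reflect|exact: ends_reflect|].
apply: (@ends_reflect _ dd _ _ 0).
have := ends_shift 2 ed; congr ends; apply/funext => n; congr dd; clear; lia.
Qed.

(** At k = 0 all coefficients are real, so real and imaginary parts decouple and the real theory
    applies to each. *)
Definition cre w (k : nat) (n : int) : R := complex.Re (Defs.comp w k n).
Definition cim w (k : nat) (n : int) : R := complex.Im (Defs.comp w k n).

Definition of_parts x y : seq6 R := fun n j => Complex (x (val j) n) (y (val j) n).

Lemma cre_of_parts x y k : (k < 6)%N -> cre (of_parts x y) k = x k.
Proof. by move=> k6; apply/funext => n; rewrite /cre /Defs.comp /of_parts /= inordK. Qed.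

Lemma cim_of_parts x y k : (k < 6)%N -> cim (of_parts x y) k = y k.
Proof. by move=> k6; apply/funext => n; rewrite /cim /Defs.comp /of_parts /= inordK. Qed.

Lemma comp_val w n (j : 'I_6) : w n j = Defs.comp w (val j) n.
Proof. by rewrite /Defs.comp inord_val. Qed.

Lemma eq_seq6 w w' : (forall k, (k < 6)%N -> cre w k = cre w' k /\ cim w k = cim w' k) ->
  w = w'.
Proof.
move=> h; apply/funext => n; apply/funext => j; rewrite !comp_val.
have [hr hi] := h (val j) (ltn_ord j).
move/(congr1 (fun f => f n)): hr; move/(congr1 (fun f => f n)): hi.
rewrite /cre /cim; case: (Defs.comp w _ n) => a1 a2; case: (Defs.comp w' _ n) => b1 b2 /=.
by move=> -> ->.
Qed.

(** Encodes y = H(0) x for real sequences; the minus signs of H(0) are carried by y. *)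
Definition real_system x y : Prop :=
  upper_block (x 3%N) (x 4%N) (x 5%N)
    (fun n => - y 0%N n) (fun n => - y 1%N n) (fun n => - y 2%N n) /\
  lower_block (fun n => x 0%N (0 - n)) (fun n => x 1%N (0 - n)) (fun n => x 2%N (0 - n))
    (fun n => - y 3%N (0 - n)) (fun n => - y 4%N (0 - n)) (fun n => - y 5%N (0 - n)).

Lemma expi0 : expi (0 : R) = 1.
Proof. by rewrite /expi cos0 sin0. Qed.

Lemma ReD (z z' : C) : complex.Re (z + z') = complex.Re z + complex.Re z'.
Proof. by case: z; case: z'. Qed.
Lemma ImD (z z' : C) : complex.Im (z + z') = complex.Im z + complex.Im z'.
Proof. by case: z; case: z'. Qed.
Lemma ReN (z : C) : complex.Re (- z) = - complex.Re z.
Proof. by case: z. Qed.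
Lemma ImN (z : C) : complex.Im (- z) = - complex.Im z.
Proof. by case: z. Qed.
Lemma Re_rCM a (z : C) : complex.Re (rC a * z) = a * complex.Re z.
Proof. by case: z => u v /=; rewrite mul0r subr0. Qed.
Lemma Im_rCM a (z : C) : complex.Im (rC a * z) = a * complex.Im z.
Proof. by case: z => u v /=; rewrite mul0r addr0. Qed.

Lemma real_system_of_rows x y :
  (forall n, [/\ y 0%N n = - b n * x 3%N n - b n * x 4%N n - cc n * x 5%N (n + 1),
    y 1%N n = - b n * x 3%N n - dd (n - 2) * x 4%N (n - 2) - b n * x 5%N n &
    y 2%N n = - cc n * x 3%N (n + 1) - b n * x 4%N n - b n * x 5%N n]) ->
  (forall n, [/\ y 3%N n = - b n * x 0%N n - b n * x 1%N n - cc (n - 1) * x 2%N (n - 1),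
    y 4%N n = - b n * x 0%N n - dd n * x 1%N (n + 2) - b n * x 2%N n &
    y 5%N n = - cc (n - 1) * x 0%N (n - 1) - b n * x 1%N n - b n * x 2%N n]) ->
  real_system x y.
Proof.
move=> hu hl; split=> n.
  by have [-> -> ->] := hu n; split; ring.
have [-> -> ->] := hl (0 - n).
rewrite (_ : 0 - n - 1 = - 1 - n); last by clear; lia.
rewrite (_ : 0 - (n + 1) = - 1 - n); last by clear; lia.
rewrite (_ : 0 - (n - 2) = 0 - n + 2); last by clear; lia.
by split; ring.
Qed.

Lemma real_system_H w :
  real_system (cre w) (cre (H w)) /\ real_system (cim w) (cim (H w)).
Proof.
split; apply: real_system_of_rows => n; split;
  rewrite /cre /cim {1}/Defs.comp /H /H_II [val _]inordK //= ?expi0 ?invr1 ?mulr1;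
  by rewrite ?(mulNr, ReD, ImD, ReN, ImN, Re_rCM, Im_rCM).
Qed.

Lemma real_system_unique x y y' k : (k < 6)%N ->
  real_system x y -> real_system x y' -> y k = y' k.
Proof.
move=> k6 [u l] [u' l']; apply/funext => n; move: k6.
have {n}[n ->] : exists m, n = 0 - m by exists (0 - n); clear; lia.
have [e4 e5 e6] := l n; have [e4' e5' e6'] := l' n.
have [e1 e2 e3] := u (0 - n); have [e1' e2' e3'] := u' (0 - n).
case: k => [|[|[|[|[|[|//]]]]]] _; apply: oppr_inj.
- by rewrite -e1 -e1'.
- by rewrite -e2 -e2'.
- by rewrite -e3 -e3'.
- by rewrite -e4 -e4'.
- by rewrite -e5 -e5'.
- by rewrite -e6 -e6'.
Qed.

(** The system determines its right side, and H w is one such right side. *)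
Lemma H_of_system w w' : real_system (cre w) (cre w') -> real_system (cim w) (cim w') ->
  H w = w'.
Proof.
move=> hr hi; have [hr' hi'] := real_system_H w.
by apply: eq_seq6 => k k6; split; [exact: real_system_unique hr|exact: real_system_unique hi].
Qed.

Lemma sum_ptnorm2 w N :
  \sum_(i < N) (ptnorm2 (w (Posz i)) + ptnorm2 (w (Negz i))) =
  \sum_(j < 6) \sum_(i < N) ((cre w j (Posz i) ^+ 2 + cre w j (Negz i) ^+ 2) +
     (cim w j (Posz i) ^+ 2 + cim w j (Negz i) ^+ 2)).
Proof.
rewrite exchange_big /=; apply: eq_bigr => i _; rewrite /ptnorm2 -big_split /=.
apply: eq_bigr => j _; rewrite !comp_val /sqmod /cre /cim /=; ring.
Qed.

Lemma ptnorm2_ge0 (v : 'I_6 -> C) : 0 <= ptnorm2 v.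
Proof. by apply: sumr_ge0 => j _; rewrite addr_ge0 ?sqr_ge0. Qed.

Lemma l2norm2_leP w (M : R) : (l2norm2 w <= M%:E)%E <->
  forall N, \sum_(i < N) (ptnorm2 (w (Posz i)) + ptnorm2 (w (Negz i))) <= M.
Proof.
have t0 n : (0%:E <= (ptnorm2 (w (Posz n)) + ptnorm2 (w (Negz n)))%:E)%E.
  by rewrite lee_fin addr_ge0 ?ptnorm2_ge0.
split=> [wM N|wM].
  rewrite -lee_fin; apply: le_trans wM.
  rewrite -sumEFin -(big_mkord xpredT
    (fun i => (ptnorm2 (w (Posz i)) + ptnorm2 (w (Negz i)))%:E)).
  by apply: nneseries_lim_ge.
apply: lime_le; first by apply: is_cvg_nneseries.
by apply: nearW => N; rewrite big_mkord sumEFin lee_fin.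
Qed.

Lemma l2norm2_le_parts w (M : R) k : (l2norm2 w <= M%:E)%E -> (k < 6)%N ->
  l2le (cre w k) M /\ l2le (cim w k) M.
Proof.
move=> /l2norm2_leP wM k6; split; apply/l2leP => N; apply: le_trans (wM N);
  rewrite sum_ptnorm2 (bigD1 (Ordinal k6)) //= [X in _ <= X + _]big_split /=.
- rewrite -addrA lerDl addr_ge0 ?sumr_ge0 // => [i _|j _]; first by rewrite addr_ge0 ?sqr_ge0.
  by apply: sumr_ge0 => i _; rewrite !addr_ge0 ?sqr_ge0.
- rewrite addrAC lerDr addr_ge0 ?sumr_ge0 // => [i _|j _]; first by rewrite addr_ge0 ?sqr_ge0.
  by apply: sumr_ge0 => i _; rewrite !addr_ge0 ?sqr_ge0.
Qed.

(** The 12 counts six components with two real parts each. *)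
Lemma parts_l2norm2_le w (M : R) :
  (forall k, (k < 6)%N -> l2le (cre w k) M /\ l2le (cim w k) M) ->
  (l2norm2 w <= (12 * M)%:E)%E.
Proof.
move=> h; apply/l2norm2_leP => N; rewrite sum_ptnorm2.
apply: (@le_trans _ _ (\sum_(j < 6) (M + M))).
  apply: ler_sum => j _; rewrite big_split.
  have [/l2leP hr /l2leP hi] := h j (ltn_ord j).
  by apply: lerD; [exact: hr|exact: hi].
by rewrite sumr_const card_ord -mulr_natl; lra.
Qed.

Lemma l2norm2_ge0 w : (0%:E <= l2norm2 w)%E.
Proof. by apply: nneseries_ge0 => n _ _; rewrite lee_fin addr_ge0 ?ptnorm2_ge0. Qed.

Lemma in_l2_fin w : in_l2 w -> l2norm2 w = (fine (l2norm2 w))%:E.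
Proof. by move=> lw; rewrite fineK // ge0_fin_numE // l2norm2_ge0. Qed.

Lemma in_l2P w : in_l2 w <->
  forall k, (k < 6)%N -> l2 (cre w k) /\ l2 (cim w k).
Proof.
split=> [lw k k6|h].
  have [hr hi] : l2le (cre w k) (fine (l2norm2 w)) /\ l2le (cim w k) (fine (l2norm2 w)).
    by apply: l2norm2_le_parts; rewrite -?in_l2_fin.
  by split; eexists; eassumption.
have [M hM] : exists M, forall k, (k < 6)%N -> l2le (cre w k) M /\ l2le (cim w k) M.
  move: h; elim: 6%N => [|m IH] h; first by exists 0.
  have [k km|M hM] := IH; first by apply: h; rewrite ltnW.
  have [[M1 h1] [M2 h2]] := h m (ltnSn m).
  have M10 := l2le_ge0 h1; have M20 := l2le_ge0 h2.
  exists (Num.max M (Num.max M1 M2)) => k; rewrite ltnS leq_eqVlt => /orP[/eqP ->|km].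
    by split; [apply: l2le_mono h1|apply: l2le_mono h2]; rewrite !le_max lexx !orbT.
  by have [? ?] := hM k km; split; apply: l2le_mono; try eassumption; rewrite le_max lexx.
exact: le_lt_trans (parts_l2norm2_le hM) (ltry _).
Qed.

Lemma in_l2_lin (s t : C) (u v : seq6 R) : in_l2 u -> in_l2 v ->
  in_l2 (add6 (scale6 s u) (scale6 t v)).
Proof.
move=> /in_l2P lu /in_l2P lv; apply/in_l2P => k k6.
have [ur ui] := lu k k6; have [vr vi] := lv k k6.
case: s t => [s1 s2] [t1 t2]; split.
- apply: eq_l2 (l2D (l2D (l2Z s1 ur) (l2Z (- s2) ui)) (l2D (l2Z t1 vr) (l2Z (- t2) vi))) => n.
  rewrite /cre /cim /Defs.comp /add6 /scale6.
  by case: (u n _) => ? ?; case: (v n _) => ? ? /=; ring.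
- apply: eq_l2 (l2D (l2D (l2Z s1 ui) (l2Z s2 ur)) (l2D (l2Z t1 vi) (l2Z t2 vr))) => n.
  rewrite /cre /cim /Defs.comp /add6 /scale6.
  by case: (u n _) => ? ?; case: (v n _) => ? ? /=; ring.
Qed.

Lemma H_lin (s t : C) (u v : seq6 R) :
  H (add6 (scale6 s u) (scale6 t v)) = add6 (scale6 s (H u)) (scale6 t (H v)).
Proof.
apply/funext => n; apply/funext => j.
rewrite /H /H_II /add6 /scale6 /Defs.comp.
by case: (val j) => [|[|[|[|[|?]]]]]; ring.
Qed.

Lemma l2_unreflect (f : int -> R) : l2 (fun n => - f (0 - n)) -> l2 f.
Proof.
move=> /(l2Z (-1)) /(l2_reflect 0); apply: eq_l2 => n.
by rewrite mulN1r opprK !sub0r opprK.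
Qed.

Lemma real_system_l2 x y : real_system x y -> (forall k, (k < 6)%N -> l2 (x k)) ->
  forall k, (k < 6)%N -> l2 (y k).
Proof.
move=> [u l] lx k k6.
have [x0 x1 x2 [x3 x4 x5]] : [/\ l2 (x 0%N), l2 (x 1%N), l2 (x 2%N) &
    [/\ l2 (x 3%N), l2 (x 4%N) & l2 (x 5%N)]] by split; [| | |split]; exact: lx.
have [u0 u1 u2] := block_l2 upper_coef u x3 x4 x5.
have [l0 l1 l2'] := block_l2 lower_coef l (l2_reflect 0 x0) (l2_reflect 0 x1) (l2_reflect 0 x2).
have neg f : l2 (fun n : int => - f n : R) -> l2 f.
  by move=> /(l2Z (-1)); apply: eq_l2 => n; rewrite mulN1r opprK.
case: k k6 => [|[|[|[|[|[|//]]]]]] _; by [exact: neg|exact: l2_unreflect].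
Qed.

Lemma H_l2 w : in_l2 w -> in_l2 (H w).
Proof.
move=> /in_l2P lw; have [hr hi] := real_system_H w; apply/in_l2P => k k6; split.
- by apply: (real_system_l2 hr) => // m /lw[].
- by apply: (real_system_l2 hi) => // m /lw[].
Qed.

(** Slots 0 to 2 hold the unknowns of the lower block, 3 to 5 those of the upper one. *)
Definition stack (p1 q1 r1 p2 q2 r2 : int -> R) (k : nat) : int -> R :=
  nth (fun=> 0) [:: p1; q1; r1; p2; q2; r2] k.

(** * Deltas of equal sign: bounded invertibility *)

Section SamePhase.
Hypothesis phase : 0 < dp * dm.

Let upper_phase : same_phase bm bp (bm + dm) (bp + dp).
Proof.
move: phase; have [m0|m0|->] := ltgtP dm 0.
- by rewrite nmulr_lgt0 // => p0; right; lra.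
- by rewrite pmulr_lgt0 // => p0; left; lra.
- by rewrite mulr0 ltxx.
Qed.

Let lower_phase : same_phase bp bm (bp + dp) (bm + dm).
Proof. by case: upper_phase => -[]; [left|right]. Qed.

Lemma real_system_solvable : exists K : R, forall M y,
  (forall k, (k < 6)%N -> l2le (y k) M) ->
  exists x, (forall k, (k < 6)%N -> l2le (x k) (K * M)) /\ real_system x y.
Proof.
have [K1 h1] := block_solvable upper_coef upper_phase.
have [K2 h2] := block_solvable lower_coef lower_phase.
exists (Num.max K1 K2) => M y hy.
have M0 := l2le_ge0 (hy 0%N isT).
have ny k : (k < 6)%N -> l2le (fun n => - y k n) M.
  move=> /hy/(l2leZ (-1)); rewrite sqrrN expr1n mul1r; congr l2le.
  by apply/funext => n; rewrite mulN1r.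
have [p2 [q2 [r2 [P2 Q2 R2 B2]]]] := h1 _ _ _ _ (ny 0%N isT) (ny 1%N isT) (ny 2%N isT).
have [p1 [q1 [r1 [P1 Q1 R1 B1]]]] := h2 _ _ _ _ (l2le_reflect 0 (ny 3%N isT))
  (l2le_reflect 0 (ny 4%N isT)) (l2le_reflect 0 (ny 5%N isT)).
exists (stack (fun n => p1 (0 - n)) (fun n => q1 (0 - n)) (fun n => r1 (0 - n)) p2 q2 r2).
split.
  case=> [|[|[|[|[|[|//]]]]]] _ /=;
    by [exact: l2le_maxl|apply: l2le_maxr => //; exact: l2le_reflect].
split=> //=.
have e (f : int -> R) : (fun n => f (0 - (0 - n))) = f.
  by apply/funext => n; rewrite !sub0r opprK.
by rewrite /stack /= !e.
Qed.

Lemma H_solvable : exists K : R, forall M w, (l2norm2 w <= M%:E)%E ->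
  exists2 v, (l2norm2 v <= (K * M)%:E)%E & H v = w.
Proof.
have [K hK] := real_system_solvable; exists (12 * K) => M w wM.
have [x [xM xE]] := hK M (cre w) (fun k k6 => (l2norm2_le_parts wM k6).1).
have [y [yM yE]] := hK M (cim w) (fun k k6 => (l2norm2_le_parts wM k6).2).
exists (of_parts x y).
  rewrite -mulrA; apply: parts_l2norm2_le => k k6.
  by rewrite cre_of_parts // cim_of_parts //; split; [exact: xM|exact: yM].
apply: H_of_system; rewrite /real_system.
- by rewrite !cre_of_parts.
- by rewrite !cim_of_parts.
Qed.

Lemma real_system_injective x : (forall k, (k < 6)%N -> l2 (x k)) ->
  real_system x (fun _ _ => 0) -> forall k n, (k < 6)%N -> x k n = 0.
Proof.
move=> lx [u l] k n; rewrite oppr0 in u l.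
have [x3 x4 x5] := block_injective upper_coef upper_phase (lx 3%N isT) (lx 4%N isT)
  (lx 5%N isT) u n.
have [] := block_injective lower_coef lower_phase (l2_reflect 0 (lx 0%N isT))
  (l2_reflect 0 (lx 1%N isT)) (l2_reflect 0 (lx 2%N isT)) l (0 - n).
rewrite !sub0r opprK => x0 x1 x2.
by case: k => [|[|[|[|[|[|//]]]]]].
Qed.

Lemma H_injective w : in_l2 w -> H w = @zero6 R -> w = @zero6 R.
Proof.
move=> /in_l2P lw Hw; have [hr hi] := real_system_H w; rewrite Hw in hr hi.
apply: eq_seq6 => k k6; split; apply/funext => n.
- by apply: (real_system_injective _ hr) => // m /lw[].
- by apply: (real_system_injective _ hi) => // m /lw[].
Qed.

Lemma H_eq w w' : in_l2 w -> in_l2 w' -> H w = H w' -> w = w'.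
Proof.
move=> lw lw' e; have := @H_injective _ (in_l2_lin 1 (-1) lw lw').
rewrite H_lin e => h.
have /h : add6 (scale6 1 (H w')) (scale6 (-1) (H w')) = @zero6 R.
  by apply/funext => n; apply/funext => j; rewrite /add6 /scale6 mul1r mulN1r subrr.
move=> h'; apply/funext => n; apply/funext => j.
have := congr1 (fun f => f n j) h'; rewrite /add6 /scale6 mul1r mulN1r.
by move=> /eqP; rewrite subr_eq0 => /eqP.
Qed.

Lemma H_invertible : invertible_on_l2 bp bm dp dm c 0.
Proof.
have [K hK] := H_solvable.
have ex w : exists v, in_l2 w -> (l2norm2 v <= K%:E * l2norm2 w)%E /\ H v = w.
  (* Outside l^2 the value of the inverse is a dummy. *)
  have [lw|nlw] := pselect (in_l2 w); last by exists w.
  have e := in_l2_fin lw.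
  have [v vM vE] := hK (fine (l2norm2 w)) w ltac:(by rewrite -e).
  by exists v => _; rewrite e -EFinM.
pose G w := projT1 (cid (ex w)).
have GP w : in_l2 w -> (l2norm2 (G w) <= K%:E * l2norm2 w)%E /\ H (G w) = w.
  exact: projT2 (cid (ex w)).
have Gl w : in_l2 w -> in_l2 (G w).
  move=> lw; have [h _] := GP w lw; apply: le_lt_trans h _.
  by rewrite (in_l2_fin lw) -EFinM ltry.
have GH w : in_l2 w -> H (G w) = w by move=> /GP[].
exists G; split=> //.
- move=> s t u v lu lv.
  (* The solution was picked by choice; it is linear because both sides are in l^2 with the same
     image under the injective [H]. *)
  have luv := in_l2_lin s t lu lv; apply: H_eq; first exact: Gl.
    by apply: in_l2_lin; exact: Gl.
  by rewrite H_lin !GH.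
- by exists K => w /GP[].
- move=> w lw; have lHw := H_l2 lw; apply: H_eq => //; first exact: Gl.
  exact: GH.
Qed.

Lemma H_no_zero_mode : ~ zero_eigenvalue bp bm dp dm c 0.
Proof. by move=> [w [[lw /(H_injective lw)]]]. Qed.

End SamePhase.

(** * Deltas of opposite sign: two zero modes *)

Section OppositePhase.
Hypothesis phase : dp * dm < 0.

Let upper_phase : opposite_phase bm bp (bm + dm) (bp + dp).
Proof.
move: phase; have [m0|m0|->] := ltgtP dm 0.
- by rewrite nmulr_llt0 // => p0; right; lra.
- by rewrite pmulr_llt0 // => p0; left; lra.
- by rewrite mulr0 ltxx.
Qed.

Let lower_phase : opposite_phase bp bm (bp + dp) (bm + dm).
Proof. by case: upper_phase => -[]; [right|left]. Qed.

(** Each block contributes one mode, and the two are supported on complementary components. *)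
Lemma H_kernel_dim2 : kernel_dim2 bp bm dp dm c 0.
Proof.
have [p2 [q2 [r2 [[lp2 lq2 lr2] B2 n2 k2]]]] := block_kernel upper_coef upper_phase.
have [p1 [q1 [r1 [[lp1 lq1 lr1] B1 n1 k1]]]] := block_kernel lower_coef lower_phase.
pose o : int -> R := fun=> 0.
have lo : l2 o := l2_0 R.
pose x1 := stack (fun n => p1 (0 - n)) (fun n => q1 (0 - n)) (fun n => r1 (0 - n)) o o o.
pose x2 := stack o o o p2 q2 r2.
have e (f : int -> R) : (fun n => f (0 - (0 - n))) = f.
  by apply/funext => n; rewrite !sub0r opprK.
have B0 b' c' d' : block b' c' d' o o o o o o.
  by move=> n; rewrite /o !mulr0 !addr0.
have oE : (fun n : int => - 0) = o by rewrite oppr0.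
have sys0 : real_system (fun=> o) (fun=> o) by split; rewrite /o oE; exact: B0.
have ker x : (forall k, (k < 6)%N -> l2 (x k)) -> real_system x (fun=> o) ->
    in_kernel bp bm dp dm c 0 (of_parts x (fun=> o)).
  move=> lx xE; split.
    by apply/in_l2P => k k6; rewrite cre_of_parts // cim_of_parts //; split => //; exact: lx.
  apply: H_of_system; rewrite /real_system.
  - by rewrite !cre_of_parts.
  - by rewrite !cim_of_parts.
exists (of_parts x1 (fun=> o)), (of_parts x2 (fun=> o)); split.
- apply: ker; first by case=> [|[|[|[|[|[|//]]]]]] _ //=; exact: l2_reflect.
  by split; rewrite /x1 /stack /= ?e /o oE; [exact: B0|exact: B1].
- apply: ker; first by case=> [|[|[|[|[|[|//]]]]]] _.
  by split; rewrite /x2 /stack /= /o oE; [exact: B2|exact: B0].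
- move=> s t st0.
  (* Evaluation at site 0, where each mode has a nonzero entry and the other mode is zero. *)
  have ent k : (k < 6)%N -> s * Complex (x1 k 0) 0 + t * Complex (x2 k 0) 0 = 0.
    move=> k6; have := congr1 (fun f => Defs.comp f k 0) st0.
    by rewrite /Defs.comp /add6 /scale6 /of_parts /= inordK.
  have zero (z : C) (a : R) : a != 0 -> z * Complex a 0 = 0 -> z = 0.
    move=> a0 /eqP; rewrite mulf_eq0 => /orP[/eqP //|/eqP[aE]].
    by rewrite aE eqxx in a0.
  split.
  + case: n1 => n1.
      have := ent 0%N isT; rewrite /= mulr0 addr0; exact: zero.
    have := ent 1%N isT; rewrite /= mulr0 addr0; exact: zero.
  + case: n2 => n2.
      have := ent 3%N isT; rewrite /= mulr0 add0r; exact: zero.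
    have := ent 4%N isT; rewrite /= mulr0 add0r; exact: zero.
move=> w [/in_l2P lw Hw]; have [hr hi] := real_system_H w; rewrite /H Hw in hr hi.
have dec x : (forall k, (k < 6)%N -> l2 (x k)) -> real_system x (fun=> o) ->
    exists s t : R, forall k n, (k < 6)%N -> x k n = s * x1 k n + t * x2 k n.
  move=> lx [u l]; rewrite /o oE in u l.
  have [t tE] := k2 _ _ _ (lx 3%N isT) (lx 4%N isT) (lx 5%N isT) u.
  have [s sE] := k1 _ _ _ (l2_reflect 0 (lx 0%N isT)) (l2_reflect 0 (lx 1%N isT))
    (l2_reflect 0 (lx 2%N isT)) l.
  exists s, t => k n; have [t3 t4 t5] := tE n.
  have := sE (0 - n); rewrite [0 - (0 - n)]sub0r [0 - n]sub0r opprK => -[s0 s1 s2].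
  case: k => [|[|[|[|[|[|//]]]]]] _; rewrite /x1 /x2 /stack /= /o ?mulr0 ?addr0 ?add0r //;
    by rewrite sub0r.
have [s1 [t1 E1]] := dec _ (fun k k6 => (lw k k6).1) hr.
have [s2 [t2 E2]] := dec _ (fun k k6 => (lw k k6).2) hi.
(* The modes are real, so the coefficients of the real and imaginary parts combine into complex
   ones. *)
exists (Complex s1 s2), (Complex t1 t2).
apply: eq_seq6 => k k6; split; apply/funext => n.
- by rewrite E1 // /cre /Defs.comp /add6 /scale6 /of_parts /= inordK // /o !mulr0 !subr0.
- rewrite E2 // /cim /Defs.comp /add6 /scale6 /of_parts /= inordK // /o !mulr0 !add0r.
  by rewrite ?[_ * s2]mulrC.
Qed.

End OppositePhase.

End Interface.

Theorem theorem14 (R : realType) (bp bm dp dm c : R) :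
  0 < bp -> 0 < bm -> 0 < bp + dp -> 0 < bm + dm -> 0 < c ->
  (dp * dm < 0 -> kernel_dim2 bp bm dp dm c 0) /\
  (0 < dp * dm ->
     invertible_on_l2 bp bm dp dm c 0 /\ ~ zero_eigenvalue bp bm dp dm c 0).
Proof.
move=> bp0 bm0 gp0 gm0 c0; split=> phase; first exact: H_kernel_dim2.
by split; [exact: H_invertible|exact: H_no_zero_mode].
Qed.
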